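(* Let $n\ge 2$ and let $\mathfrak n\subseteq\mathfrak q(n)$ be the subalgebra spanned by all $\widetilde E_{ij}$ and $\overline E_{ij}$ with $1\le i<j\le n$. Then $$\dim\operatorname{H}^2(\mathfrak n,\mathbb C)=2n^2-6n+6.$$
   Context: All spaces are over $\mathbb C$. Rows and columns of matrices in $\mathfrak{gl}(n|n)$ are indexed by $\bar1,\dots,\bar n$ (even) and $1,\dots,n$ (odd), with elementary matrices $E_{ab}$ and the supercommutator bracket. $\mathfrak q(n)$ is the subalgebra of $\mathfrak{gl}(n|n)$ spanned by the even elements $\widetilde E_{ij}=E_{\bar i\bar j}+E_{ij}$ and the odd elements $\overline E_{ij}=E_{i\bar j}+E_{\bar i j}$, $1\le i,j\le n$. $\operatorname{H}^\bullet(\mathfrak n,\mathbb C)$ is the Lie superalgebra cohomology with trivial (even, one-dimensional) coefficients, i.e. the cohomology of the complex $C^p=\operatorname{Hom}(\Lambda_s^p(\mathfrak n),\mathbb C)$ with $\Lambda_s^p(\mathfrak n)=\bigoplus_{i+j=p}\Lambda^i(\mathfrak n_{\bar0})\otimes S^j(\mathfrak n_{\bar1})$ and differential $$df(\omega_0\wedge\cdots\wedge\omega_p)=\sum_{i<j}(-1)^{\sigma_{i,j}}f([\omega_i,\omega_j]\wedge\omega_0\wedge\cdots\widehat{\omega_i}\cdots\widehat{\omega_j}\cdots\wedge\omega_p),$$ $\sigma_{i,j}=i+j+|\omega_i||\omega_j|+|\omega_i|(|\omega_0|+\cdots+|\omega_{i-1}|)+|\omega_j|(|\omega_0|+\cdots+|\omega_{j-1}|)$.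 *)

(* Defs.v *)
From HB Require Import structures.
From mathcomp Require Import all_boot all_order all_algebra.
From mathcomp Require Import reals complex ring.
Set Implicit Arguments.
Unset Strict Implicit.
Unset Printing Implicit Defensive.
Import GRing.Theory.
Local Open Scope ring_scope.

(* Parities are booleans: false is even, true is odd, (+) is their sum and    *)
(* && their product.                                                          *)

(* A numFieldType has characteristic 0, so the axioms need no supplement for  *)
(* the primes 2 and 3.                                                        *)
Record lieSuperalgebra (F : numFieldType) := LieSuperalgebra {
  lsa_sort :> vectType F;
  lsa_part : bool -> {vspace lsa_sort};
  lsa_bracket : lsa_sort -> lsa_sort -> lsa_sort;
  lsa_part_add : (lsa_part false + lsa_part true)%VS = fullv;
  lsa_part_cap : (lsa_part false :&: lsa_part true)%VS = 0%VS;
  lsa_bracket_linl : forall c x y z,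
    lsa_bracket (c *: x + y) z = c *: lsa_bracket x z + lsa_bracket y z;
  lsa_bracket_linr : forall c x y z,
    lsa_bracket z (c *: x + y) = c *: lsa_bracket z x + lsa_bracket z y;
  lsa_bracket_part : forall a b x y, x \in lsa_part a -> y \in lsa_part b ->
    lsa_bracket x y \in lsa_part (a (+) b);
  lsa_bracket_skew : forall a b x y, x \in lsa_part a -> y \in lsa_part b ->
    lsa_bracket x y = - ((-1) ^+ (a && b) *: lsa_bracket y x);
  lsa_jacobi : forall a b x y z, x \in lsa_part a -> y \in lsa_part b ->
    lsa_bracket x (lsa_bracket y z) =
      lsa_bracket (lsa_bracket x y) z
      + (-1) ^+ (a && b) *: lsa_bracket y (lsa_bracket x z)
}.

Section Cohomology.
Variables (F : numFieldType) (L : lieSuperalgebra F).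

Definition hcomp (a : bool) (x : L) : L :=
  daddv_pi (lsa_part L a) (lsa_part L (~~ a)) x.

(* p-linear forms on L, in curried form. *)
Fixpoint mform (p : nat) : vectType F :=
  if p is q.+1 then 'Hom(L, mform q) else F^o.

(* meval f [:: x_1; ...; x_p] is f(x_1, ..., x_p). *)
Fixpoint meval (p : nat) : mform p -> seq L -> F :=
  match p return mform p -> seq L -> F with
  | 0 => fun f _ => f
  | q.+1 => fun f w => meval (f (head 0 w)) (behead w)
  end.

(* w is a sequence of homogeneous elements whose parities are listed by e;    *)
(* in particular both have the same size.                                     *)
Definition homogeneous (e : seq bool) (w : seq L) : bool :=
  all2 (fun a x => x \in lsa_part L a) e w.

(* The p-linear form whose value on homogeneous w, of parities e, is          *)
(* phi e w, for phi linear in each entry of w: see mformE.                    *)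
Fixpoint mform_of (p : nat) : (seq bool -> seq L -> F) -> mform p :=
  match p return (seq bool -> seq L -> F) -> mform p with
  | 0 => fun phi => phi [::] [::]
  | q.+1 => fun phi =>
      linfun (fun x => \sum_a mform_of q (fun e w => phi (a :: e) (hcomp a x :: w)))
  end.

(* Exchanges the entries of w at positions k and k.+1. *)
Fixpoint swap_at (k : nat) (w : seq L) : seq L :=
  match k, w with
  | 0, x :: y :: v => y :: x :: v
  | q.+1, x :: v => x :: swap_at q v
  | _, _ => w
  end.

Definition superswap (p k : nat) : 'End(mform p) :=
  linfun (fun f : mform p => mform_of p (fun e w =>
    (-1) ^+ (nth false e k && nth false e k.+1) * meval f (swap_at k w))).

(* Hom(Lambda_s^p(L), F), as the space of super-alternating p-linear forms:   *)
(*   f(.., x, y, ..) = - (-1)^(|x||y|) f(.., y, x, ..),                       *)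
(* f(x_1, ..., x_p) being the value at x_1 /\ ... /\ x_p.  See cochainP.      *)
Definition cochains (p : nat) : {vspace mform p} :=
  (\bigcap_(k < p.-1) lker (superswap p k + \1%VF)%R)%VS.

(* sigma_{i,j} for the parities e of omega_0, ..., omega_p. *)
Definition sigma (e : seq bool) (i j : nat) : nat :=
  (i + j + nth false e i * nth false e j
   + nth false e i * \sum_(0 <= k < i) nth false e k
   + nth false e j * \sum_(0 <= k < j) nth false e k)%N.

(* [omega_i, omega_j] followed by the omega_k with k different from i and j. *)
Definition contract (w : seq L) (i j : nat) : seq L :=
  lsa_bracket w`_i w`_j
    :: [seq w`_k | k <- iota 0 (size w) & (k != i) && (k != j)].

Definition dformula (p : nat) (f : mform p) (e : seq bool) (w : seq L) : F :=
  \sum_(0 <= j < p.+1) \sum_(0 <= i < j)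
    (-1) ^+ sigma e i j * meval f (contract w i j).

Definition differential (p : nat) : 'Hom(mform p, mform p.+1) :=
  linfun (fun f : mform p => mform_of p.+1 (dformula f)).

Definition cocycles (p : nat) : {vspace mform p} :=
  (cochains p :&: lker (differential p))%VS.

Definition coboundaries (p : nat) : {vspace mform p} :=
  match p return {vspace mform p} with
  | 0 => 0%VS
  | q.+1 => (differential q @: cochains q)%VS
  end.

(* U :\: V is a complement of U :&: V in U, so this is a model of the quotient *)
(* of the cocycles by the coboundaries (for p = 2, see coboundaries2_sub).    *)
Definition cohomology (p : nat) : {vspace mform p} :=
  (cocycles p :\: coboundaries p)%VS.

(* Linearity of phi in each of its p vector arguments. *)
Definition multilinear (p : nat) (phi : seq L -> F) : Prop :=
  forall u v c x y, (size u + (size v).+1)%N = p ->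
    phi (u ++ (c *: x + y) :: v) = c * phi (u ++ x :: v) + phi (u ++ y :: v).

Lemma hcomp_lin a c x y : hcomp a (c *: x + y) = c *: hcomp a x + hcomp a y.
Proof. by rewrite /hcomp linearP. Qed.

Lemma lsa_part_capN a : (lsa_part L a :&: lsa_part L (~~ a) = 0)%VS.
Proof. by case: a; [rewrite capvC|]; exact: lsa_part_cap. Qed.

Lemma hcomp_id a b x : x \in lsa_part L b -> hcomp a x = if a == b then x else 0.
Proof.
move=> xb; rewrite /hcomp; have [->|neq] := eqVneq a b.
  by rewrite daddv_pi_id // lsa_part_capN.
have eb : b = ~~ a by case: a b neq {xb} => [] [].
have := daddv_pi_add (lsa_part_capN a) (w := x).
have xs : x \in (lsa_part L a + lsa_part L (~~ a))%VS.
  by apply: (subvP (addvSr _ _)); rewrite -eb.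
move/(_ xs); have -> : daddv_pi (lsa_part L (~~ a)) (lsa_part L a) x = x.
  by apply: daddv_pi_id; [rewrite capvC lsa_part_capN | rewrite -eb].
by move/(congr1 (fun z => z - x)); rewrite addrK subrr.
Qed.

Lemma meval_lin p c (f g : mform p) w :
  meval (c *: f + g) w = c * meval f w + meval g w.
Proof.
elim: p f g w => [|p IH] f g w //=.
by rewrite add_lfunE scale_lfunE IH.
Qed.

Lemma meval_multilinear p (f : mform p) : multilinear p (meval f).
Proof.
elim: p f => [|p IH] f [|x0 u] v c x y //= => [_|[sz]].
  by rewrite linearP meval_lin.
exact: IH.
Qed.


Lemma linfun_linE (U V : vectType F) (f : U -> V) :
  (forall c x y, f (c *: x + y) = c *: f x + f y) -> linfun f =1 f.
Proof.
move=> flin.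
pose g : {linear U -> V} := HB.pack f (GRing.isLinear.Build F U V *:%R f flin).
exact: (lfunE g).
Qed.

Lemma eq_linfun (U V : vectType F) (f g : U -> V) : f =1 g -> linfun f = linfun g.
Proof.
by move=> eqfg; rewrite unlock; congr Hom; apply/matrixP=> i j; rewrite !mxE /= eqfg.
Qed.

Lemma eq_mform_of p (phi psi : seq bool -> seq L -> F) :
  (forall e w, size w = p -> phi e w = psi e w) ->
  mform_of p phi = mform_of p psi.
Proof.
elim: p phi psi => [|p IH] phi psi eqp /=; first exact: eqp.
apply: eq_linfun => x; apply: eq_bigr => a _; apply: IH => e w sz.
by apply: eqp; rewrite /= sz.
Qed.

Lemma multilinear_cons p phi x : multilinear p.+1 phi ->
  multilinear p (fun w => phi (x :: w)).
Proof.
by move=> ml u v c y z sz; apply: (ml (x :: u)); rewrite /= addSn sz.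
Qed.

Lemma mform_of_step p phi :
  (forall phi psi c, (forall e, multilinear p (phi e)) ->
     (forall e, multilinear p (psi e)) ->
     mform_of p (fun e w => c * phi e w + psi e w)
       = c *: mform_of p phi + mform_of p psi) ->
  (forall e, multilinear p.+1 (phi e)) -> forall c x y,
  let g x := \sum_a mform_of p (fun e w => phi (a :: e) (hcomp a x :: w)) in
  g (c *: x + y) = c *: g x + g y.
Proof.
move=> linp ml c x y /=; rewrite scaler_sumr -big_split; apply: eq_bigr => a _ /=.
rewrite -linp; [|by move=> e; exact: multilinear_cons..].
apply: eq_mform_of => e w sz; rewrite hcomp_lin.
by apply: (ml _ [::]); rewrite /= sz.
Qed.

Lemma mform_of_lin p phi psi c :
  (forall e, multilinear p (phi e)) -> (forall e, multilinear p (psi e)) ->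
  mform_of p (fun e w => c * phi e w + psi e w)
    = c *: mform_of p phi + mform_of p psi.
Proof.
elim: p phi psi c => [//|p IH] phi psi c mlphi mlpsi /=.
have ml e : multilinear p.+1 (fun w => c * phi e w + psi e w).
  move=> u v d y z sz; rewrite mlphi ?mlpsi // !mulrDr !mulrA [c * d]mulrC.
  by rewrite addrACA.
have step := mform_of_step (fun phi' psi' c' => IH phi' psi' c').
apply/lfunP=> x; rewrite add_lfunE scale_lfunE.
rewrite (linfun_linE (step _ mlphi)) (linfun_linE (step _ mlpsi)).
rewrite (linfun_linE (step _ ml)).
rewrite scaler_sumr -big_split; apply: eq_bigr => a _ /=.
by rewrite -IH // => e; exact: multilinear_cons.
Qed.

Lemma mformE p phi e w : (forall e, multilinear p (phi e)) ->
  size w = p -> homogeneous e w -> meval (mform_of p phi) w = phi e w.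
Proof.
elim: p phi e w => [|p IH] phi [|a e] [|x w] //= ml [sz] /andP[xa hw].
rewrite linfun_linE; last by apply: mform_of_step => //; exact: mform_of_lin.
rewrite (bigD1 a) //= big1 => [|b nba]; last first.
  rewrite (hcomp_id _ xa) (negPf nba).
  have ml0 (e' : seq bool) : multilinear p (fun=> 0) by move=> ? ? ? ? ? ?; rewrite mulr0 addr0.
  have z0 : mform_of p (fun _ _ => 0 : F) = 0.
    have := @mform_of_lin p (fun _ _ => 0) (fun _ _ => 0) (-1).
    rewrite scaleN1r addNr => /(_ ml0 ml0) <-; apply: eq_mform_of => ? ? _.
    by rewrite mulr0 addr0.
  rewrite -[RHS]z0; apply: eq_mform_of => e' w' sz'.
  have := ml (b :: e') [::] w' (-1) 0 0; rewrite /= sz' => /(_ erefl).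
  by rewrite scaler0 addr0 mulN1r addNr.
rewrite addr0 (IH _ e) //.
  by rewrite (hcomp_id _ xa) eqxx.
by move=> e'; exact: multilinear_cons.
Qed.

Lemma nth_mid (u v : seq L) x k : k != size u ->
  (u ++ x :: v)`_k = (u ++ 0 :: v)`_k.
Proof.
move=> nk; rewrite !nth_cat; case: ltnP => // le.
have : (0 < k - size u)%N by rewrite subn_gt0 ltn_neqAle eq_sym nk.
by case: (k - size u)%N.
Qed.


Lemma size_skip2 i j p : (i < j)%N -> (j < p)%N ->
  size [seq k <- iota 0 p | (k != i) && (k != j)] = p.-2.
Proof.
move=> ij jp; have ip := ltn_trans ij jp.
rewrite size_filter; have := count_predC (pred2 i j) (iota 0 p).
have := count_predUI (pred1 i) (pred1 j) (iota 0 p).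
have -> : count (predI (pred1 i) (pred1 j)) (iota 0 p) = 0%N.
  rewrite -[RHS](count_pred0 (iota 0 p)); apply: eq_count.
  by move=> k /=; apply/negP=> /andP[/eqP-> /eqP e]; rewrite e ltnn in ij.
rewrite addn0 !count_uniq_mem ?iota_uniq // !mem_iota /= !add0n ip jp.
rewrite size_iota => e1.
have -> : count (pred2 i j) (iota 0 p) = 2.
  by rewrite -(eq_count (a1 := predU (pred1 i) (pred1 j))) ?e1.
have -> : count (predC (pred2 i j)) (iota 0 p)
    = count (fun k => (k != i) && (k != j)) (iota 0 p).
  by apply: eq_count => k /=; rewrite negb_or.
by move=> e2; rewrite -[in RHS]e2 add2n.
Qed.

Lemma contract_multilinear p (f : mform p) i j : (i < j)%N -> (j < p.+1)%N ->
  multilinear p.+1 (fun w => meval f (contract w i j)).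
Proof.
case: p f => [|p] f ij jp; first by case: j ij jp => [|[]].
move=> u v c x y sz; rewrite /contract.
have szw z : size (u ++ z :: v) = p.+2 by rewrite size_cat.
have up : (size u < p.+2)%N by rewrite -sz addnS ltnS leq_addr.
rewrite !szw; have := size_skip2 ij jp.
set s := filter _ _ => /= szs.
have nthu z : (u ++ z :: v)`_(size u) = z by rewrite nth_cat ltnn subnn.
have mp z w : size u \notin w ->
    [seq (u ++ z :: v)`_k | k <- w] = [seq (u ++ 0 :: v)`_k | k <- w].
  move=> nw; apply/eq_in_map => k kw; apply: nth_mid.
  by apply: contraNN nw => /eqP <-.
have us : uniq s by rewrite filter_uniq ?iota_uniq.
have [us'|nus] := boolP (size u \in s).
  move: (us'); rewrite mem_filter => /andP[/andP[ui uj] _].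
  rewrite !(@nth_mid _ _ _ i) 1?eq_sym // !(@nth_mid _ _ _ j) 1?eq_sym //.
  move: us szs; case/splitPr: us' => s1 s2.
  rewrite cat_uniq /= negb_or size_cat /= => /and3P[_ /andP[n1 _] /andP[n2 _]] ss.
  rewrite !map_cat /= !nthu !(mp _ s1) // !(mp _ s2) //.
  by apply: meval_multilinear; rewrite !size_map ss.
rewrite !mp // (_ : lsa_bracket _ _ =
    c *: lsa_bracket (u ++ x :: v)`_i (u ++ x :: v)`_j
    + lsa_bracket (u ++ y :: v)`_i (u ++ y :: v)`_j).
  by rewrite /= linearP meval_lin.
move: nus; rewrite mem_filter mem_iota /= up andbT negb_and !negbK.
case/orP=> /eqP e.
  have nj z : (u ++ z :: v)`_j = (u ++ 0 :: v)`_j.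
    by apply: nth_mid; rewrite e gtn_eqF.
  by rewrite -e !nthu (nj (_ + _)) (nj x) (nj y); exact: lsa_bracket_linl.
have ni z : (u ++ z :: v)`_i = (u ++ 0 :: v)`_i.
  by apply: nth_mid; rewrite e ltn_eqF.
by rewrite -e !nthu (ni (_ + _)) (ni x) (ni y); exact: lsa_bracket_linr.
Qed.

Lemma dformula_multilinear p (f : mform p) e : multilinear p.+1 (dformula f e).
Proof.
rewrite /dformula => u v c x y sz; rewrite mulr_sumr -big_split /=.
apply: eq_big_nat => j /andP[_ jp].
rewrite mulr_sumr -big_split /=; apply: eq_big_nat => i /andP[_ ij].
by rewrite contract_multilinear // mulrDr mulrCA.
Qed.

Lemma dformula_lin p c (f g : mform p) e w :
  dformula (c *: f + g) e w = c * dformula f e w + dformula g e w.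
Proof.
rewrite /dformula mulr_sumr -big_split; apply: eq_bigr => j _ /=.
rewrite mulr_sumr -big_split; apply: eq_bigr => i _ /=.
by rewrite meval_lin mulrDr mulrCA.
Qed.

(* The defining formula of the differential, on homogeneous elements. *)
Lemma differentialE p (f : mform p) e w :
  size w = p.+1 -> homogeneous e w ->
  meval (differential p f) w = dformula f e w.
Proof.
move=> sz hw; rewrite /differential linfun_linE => [|c g h].
  by rewrite (mformE (e := e)) // => e'; exact: dformula_multilinear.
rewrite -mform_of_lin; [|by move=> e'; exact: dformula_multilinear..].
by apply: eq_mform_of => e' w' _; rewrite dformula_lin.
Qed.

Lemma swap_multilinear p (f : mform p) k : (k.+1 < p)%N ->
  multilinear p (fun w => meval f (swap_at k w)).
Proof.
elim: k p f => [|k IH] [|p] f //= kp [|x0 u] v c x y /= [sz].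
- case: p f kp sz => [|p] f // _; case: v => [|b v] //= _.
  by rewrite linearP meval_lin.
- case: p f kp sz => [|p] f // _; case: u => [|b u] /= sz.
    by rewrite linearP add_lfunE scale_lfunE meval_lin.
  by apply: meval_multilinear; case: sz.
- by rewrite linearP meval_lin.
- exact: IH.
Qed.

Lemma superswapE p k (f : mform p) e w : (k.+1 < p)%N ->
  size w = p -> homogeneous e w ->
  meval (superswap p k f) w
    = (-1) ^+ (nth false e k && nth false e k.+1) * meval f (swap_at k w).
Proof.
move=> kp sz hw.
have ml (g : mform p) e' : multilinear p (fun w' : seq L =>
    (-1) ^+ (nth false e' k && nth false e' k.+1) * meval g (swap_at k w')).
  move=> u v c x y sz'; rewrite swap_multilinear // mulrDr; congr (_ + _).
  by rewrite mulrCA.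
rewrite /superswap linfun_linE => [|c g h].
  by rewrite (mformE (e := e)).
rewrite -mform_of_lin; [|exact: ml..].
by apply: eq_mform_of => e' w' _; rewrite meval_lin mulrDr mulrCA.
Qed.

Lemma hcomp_part a x : hcomp a x \in lsa_part L a.
Proof. exact: memv_pi. Qed.

Lemma hcomp_add x : x = hcomp false x + hcomp true x.
Proof.
rewrite /hcomp /= daddv_pi_add ?(lsa_part_capN false) //.
by rewrite lsa_part_add memvf.
Qed.

Lemma meval_ext p (f g : mform p) :
  (forall e w, size w = p -> homogeneous e w -> meval f w = meval g w) -> f = g.
Proof.
elim: p f g => [|p IH] f g eqfg; first exact: (eqfg [::] [::]).
have eqh a x : x \in lsa_part L a -> f x = g x.
  move=> xa; apply: IH => e w sz hw; apply: (eqfg (a :: e) (x :: w)) => /=.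
    by rewrite sz.
  by rewrite xa.
apply/lfunP=> x; rewrite [x]hcomp_add !linearD.
by congr (_ + _); apply: eqh; exact: hcomp_part.
Qed.

Lemma cochainP p (f : mform p) :
  f \in cochains p <->
  forall k e w, (k.+1 < p)%N -> size w = p -> homogeneous e w ->
    meval f (swap_at k w)
      = - ((-1) ^+ (nth false e k && nth false e k.+1) * meval f w).
Proof.
have ker k : f \in lker (superswap p k + \1%VF)%R <-> superswap p k f = - f.
  rewrite memv_ker add_lfunE id_lfunE addr_eq0; split=> [/eqP //|->]; exact: eqxx.
have mopp (g : mform p) w : meval (- g) w = - meval g w.
  have := meval_lin (-1) g 0 w; rewrite addr0 scaleN1r => ->.
  have := meval_lin (-1) 0 (0 : mform p) w; rewrite scaler0 addr0.
  by rewrite mulN1r addNr => ->; rewrite addr0 mulN1r.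
split=> [fC k e w kp sz hw|fC].
  have kp' : (k < p.-1)%N by case: p kp {f ker mopp fC sz}.
  have /ker := subvP (bigcapv_inf (Ordinal kp') isT (subvv _)) f fC.
  move/(congr1 (fun g => meval g w)); rewrite (superswapE _ kp sz hw) mopp.
  move/(congr1 (fun t => (-1) ^+ (nth false e k && nth false e k.+1) * t)).
  by rewrite mulrA -signr_addb addbb mul1r mulrN.
suff : (<[f]> <= cochains p)%VS by rewrite -memvE.
apply/subv_bigcapP => k _; rewrite -memvE; apply/ker/meval_ext => e w sz hw.
have kp : (k.+1 < p)%N by case: p k {f fC ker mopp sz} => [|p] [].
rewrite (superswapE _ kp sz hw) mopp (fC _ _ _ kp sz hw) mulrN.
by rewrite mulrA -signr_addb addbb mul1r.
Qed.

Lemma cocycleP p (f : mform p) :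
  f \in cocycles p <-> f \in cochains p /\
  forall e w, size w = p.+1 -> homogeneous e w -> dformula f e w = 0.
Proof.
have m0 w : meval (0 : mform p.+1) w = 0.
  have := meval_lin (-1) (0 : mform p.+1) 0 w.
  by rewrite scaler0 addr0 mulN1r addNr.
rewrite memv_cap memv_ker; split=> [/andP[fC /eqP df]|[-> df]].
  by split=> // e w sz hw; rewrite -(differentialE _ sz hw) df m0.
apply/eqP/meval_ext => e w sz hw.
by rewrite (differentialE _ sz hw) df ?m0.
Qed.

Lemma differential1E (f : mform 1) a b x y :
  x \in lsa_part L a -> y \in lsa_part L b ->
  meval (differential 1 f) [:: x; y] = - meval f [:: lsa_bracket x y].
Proof.
move=> xa yb; rewrite (@differentialE 1 f [:: a; b]) //=; last by rewrite xa yb.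
rewrite /dformula !big_nat_recr //= !big_geq // !add0r.
rewrite /sigma /contract /= !big_nat_recr //= !big_geq // add0n.
by rewrite -signr_odd (_ : odd _ = true) ?expr1 ?mulN1r //; case: a b {xa yb} => [] [].
Qed.

Lemma coboundaries2_sub : (coboundaries 2 <= cocycles 2)%VS.
Proof.
apply/subvP=> _ /memv_imgP[f _ ->]; apply/cocycleP; split.
  apply/cochainP => -[|k] e w //= _.
  case: w => [|x [|y []]] //= _; case: e => [|a [|b []]] //=; rewrite ?andbF //.
  case/and3P=> xa yb _.
  have := differential1E f yb xa; have := differential1E f xa yb; rewrite /=.
  move=> -> ->; rewrite (lsa_bracket_skew yb xa) linearN linearZ /=.
  by rewrite mulrN !opprK andbC.
move=> e w; case: w => [|x [|y [|z []]]] //= _.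
case: e => [|a [|b [|c []]]] //=; rewrite ?andbF //; case/and4P=> xa yb zc _.
rewrite /dformula !big_nat_recr //= !big_geq // !add0r.
have := differential1E f (lsa_bracket_part xa yb) zc.
have := differential1E f (lsa_bracket_part xa zc) yb.
have := differential1E f (lsa_bracket_part yb zc) xa.
rewrite /= => -> -> ->; rewrite /sigma /= !big_nat_recr //= !big_geq // !add0n.
rewrite (lsa_bracket_skew (lsa_bracket_part yb zc) xa) (lsa_jacobi z xa yb).
rewrite (lsa_bracket_skew (lsa_bracket_part xa zc) yb).
rewrite !(linearN, linearZ, linearD) /=.
have sg k : (-1) ^+ k = (if odd k then -1 else 1) :> F.
  by rewrite -signr_odd; case: (odd k).
rewrite !sg !(oddD, oddM, oddb) /=.
set A := lsa_bracket (lsa_bracket x y) z; set B := lsa_bracket y _.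
move: (f A : F) (f B : F) => fA fB.
rewrite {A B} /GRing.scale.
case: a b c {xa yb zc} => [] [] []; rewrite /=; ring.
Qed.

End Cohomology.

Section SubSuperalgebra.
Variables (F : numFieldType) (L : lieSuperalgebra F) (U : {vspace L}).
Hypothesis U_graded : (U <= (U :&: lsa_part L false) + (U :&: lsa_part L true))%VS.
Hypothesis U_bracket : forall x y, x \in U -> y \in U -> lsa_bracket x y \in U.

Definition sub_part (a : bool) : {vspace subvs_of U} :=
  (linfun (vsval : subvs_of U -> L) @^-1: lsa_part L a)%VS.

Definition sub_bracket (x y : subvs_of U) : subvs_of U :=
  vsproj U (lsa_bracket (vsval x) (vsval y)).

Lemma mem_sub_part a x : (x \in sub_part a) = (vsval x \in lsa_part L a).
Proof. by rewrite -memv_preim lfunE. Qed.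

Lemma sub_bracketE x y : vsval (sub_bracket x y) = lsa_bracket (vsval x) (vsval y).
Proof. by rewrite vsprojK // U_bracket ?subvsP. Qed.

Lemma sub_part_add : (sub_part false + sub_part true)%VS = fullv.
Proof.
apply/eqP; rewrite eqEsubv subvf /=; apply/subvP=> x _.
have /(subvP U_graded)/memv_addP[y] := subvsP x.
rewrite memv_cap => /andP[yU y0] [z]; rewrite memv_cap => /andP[zU z1] e.
have -> : x = vsproj U y + vsproj U z.
  by apply: subvs_inj; rewrite /= e !vsprojK.
by rewrite memv_add // mem_sub_part vsprojK.
Qed.

Lemma sub_part_cap : (sub_part false :&: sub_part true)%VS = 0%VS.
Proof.
apply/eqP; rewrite -subv0; apply/subvP=> x.
rewrite memv_cap !mem_sub_part => x01.
have : vsval x \in (lsa_part L false :&: lsa_part L true)%VS by rewrite memv_cap.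
rewrite lsa_part_cap memv0 => /eqP x0.
by rewrite memv0; apply/eqP/val_inj; rewrite /= x0.
Qed.

Lemma vsval_lin c (x y : subvs_of U) :
  vsval (c *: x + y) = c *: vsval x + vsval y.
Proof. exact: (linearP vsval). Qed.

Lemma sub_bracket_linl c x y z :
  sub_bracket (c *: x + y) z = c *: sub_bracket x z + sub_bracket y z.
Proof.
by apply: subvs_inj; rewrite vsval_lin !sub_bracketE vsval_lin lsa_bracket_linl.
Qed.

Lemma sub_bracket_linr c x y z :
  sub_bracket z (c *: x + y) = c *: sub_bracket z x + sub_bracket z y.
Proof.
by apply: subvs_inj; rewrite vsval_lin !sub_bracketE vsval_lin lsa_bracket_linr.
Qed.

Lemma sub_bracket_part a b x y : x \in sub_part a -> y \in sub_part b ->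
  sub_bracket x y \in sub_part (a (+) b).
Proof. by rewrite !mem_sub_part sub_bracketE; exact: lsa_bracket_part. Qed.

Lemma sub_bracket_skew a b x y : x \in sub_part a -> y \in sub_part b ->
  sub_bracket x y = - ((-1) ^+ (a && b) *: sub_bracket y x).
Proof.
rewrite !mem_sub_part => xa yb; apply: subvs_inj.
have vN (u : subvs_of U) : vsval (- u) = - vsval u by exact: (raddfN vsval).
have vZ c (u : subvs_of U) : vsval (c *: u) = c *: vsval u by exact: (linearZZ vsval).
by rewrite vN vZ !sub_bracketE (lsa_bracket_skew xa yb).
Qed.

Lemma sub_jacobi a b x y z : x \in sub_part a -> y \in sub_part b ->
  sub_bracket x (sub_bracket y z) =
    sub_bracket (sub_bracket x y) z
    + (-1) ^+ (a && b) *: sub_bracket y (sub_bracket x z).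
Proof.
rewrite !mem_sub_part => xa yb; apply: subvs_inj.
by rewrite addrC vsval_lin !sub_bracketE addrC (lsa_jacobi _ xa yb).
Qed.

Definition subSuperalgebra : lieSuperalgebra F :=
  LieSuperalgebra sub_part_add sub_part_cap sub_bracket_linl sub_bracket_linr
    sub_bracket_part sub_bracket_skew sub_jacobi.

End SubSuperalgebra.

Section GL.
Variables (F : numFieldType) (n : nat).

(* The indices of the rows and columns of gl(n|n) are 'I_(n + n): the even    *)
(* index with bar i is lshift n i, the odd index i is rshift n i.             *)
Definition idx_odd (r : 'I_(n + n)) : bool := (n <= r)%N.

Definition gl_part (a : bool) : {vspace 'M[F]_(n + n)} :=
  (\sum_(rs : 'I_(n + n) * 'I_(n + n) | idx_odd rs.1 (+) idx_odd rs.2 == a)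
     <[delta_mx rs.1 rs.2]>)%VS.

Definition gl_comp (a : bool) (X : 'M[F]_(n + n)) : 'M[F]_(n + n) :=
  \matrix_(r, s) (if idx_odd r (+) idx_odd s == a then X r s else 0).

(* The supercommutator X Y - (-1)^(|X||Y|) Y X, extended bilinearly. *)
Definition gl_bracket (X Y : 'M[F]_(n + n)) : 'M[F]_(n + n) :=
  \sum_a \sum_b (gl_comp a X *m gl_comp b Y
                 - (-1) ^+ (a && b) *: (gl_comp b Y *m gl_comp a X)).

Lemma gl_partP a (X : 'M[F]_(n + n)) : reflect (forall r s, idx_odd r (+) idx_odd s != a -> X r s = 0)
  (X \in gl_part a).
Proof.
apply: (iffP idP) => [/memv_sumP[Y Ya ->] r s ne|X0].
  rewrite summxE big1 // => -[r' s'] /= rs'; have /= := Ya (r', s') rs'.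
  case/vlineP=> c ->; rewrite !mxE.
  case: eqP => [er|]; last by rewrite mulr0.
  case: eqP => [es|]; last by rewrite mulr0.
  by rewrite er es rs' in ne.
rewrite [X]matrix_sum_delta pair_big /=; apply: memv_suml => -[r s] _ /=.
have [rs|/X0->] := boolP (idx_odd r (+) idx_odd s == a); last first.
  by rewrite scale0r mem0v.
apply: memvZ; apply: (subvP (sumv_sup (r, s) _ (subvv _))) => //.
exact: memv_line.
Qed.

Lemma gl_comp_part a X : gl_comp a X \in gl_part a.
Proof. by apply/gl_partP=> r s ne; rewrite mxE (negPf ne). Qed.

Lemma gl_comp_id a b X : X \in gl_part b -> gl_comp a X = if a == b then X else 0.
Proof.
move/gl_partP=> X0; apply/matrixP=> r s; rewrite mxE.
have [->|nab] := eqVneq a b.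
  by case: ifPn => // /X0.
by rewrite mxE; case: eqP => // e; rewrite X0 // e.
Qed.

Lemma gl_comp_lin a c X Y : gl_comp a (c *: X + Y) = c *: gl_comp a X + gl_comp a Y.
Proof.
by apply/matrixP=> r s; rewrite !mxE; case: ifP => // _; rewrite mulr0 addr0.
Qed.

Lemma gl_bracketE a b (X Y : 'M[F]_(n + n)) : X \in gl_part a -> Y \in gl_part b ->
  gl_bracket X Y = X *m Y - (-1) ^+ (a && b) *: (Y *m X).
Proof.
move=> Xa Yb; rewrite /gl_bracket (bigD1 a) //= [X in _ + X]big1 => [|a' na].
  rewrite addr0 (bigD1 b) //= big1 => [|b' nb].
    by rewrite addr0 (gl_comp_id _ Xa) (gl_comp_id _ Yb) !eqxx.
  by rewrite (gl_comp_id _ Yb) (negPf nb) mulmx0 mul0mx scaler0 subr0.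
apply: big1 => b' _.
by rewrite (gl_comp_id _ Xa) (negPf na) mulmx0 mul0mx scaler0 subr0.
Qed.

Lemma gl_mul_part a b (X Y : 'M[F]_(n + n)) : X \in gl_part a -> Y \in gl_part b ->
  X *m Y \in gl_part (a (+) b).
Proof.
move=> /gl_partP X0 /gl_partP Y0; apply/gl_partP => r s ne.
rewrite mxE big1 // => k _.
have [e|/X0->] := eqVneq (idx_odd r (+) idx_odd k) a; last by rewrite mul0r.
rewrite Y0 ?mulr0 //; apply: contraNneq ne => <-; rewrite -e.
by rewrite addbA -[_ (+) _ (+) idx_odd k]addbA addbb addbF.
Qed.

Lemma gl_comp_add X : X = gl_comp false X + gl_comp true X.
Proof.
by apply/matrixP=> r s; rewrite !mxE; case: (_ (+) _); rewrite /= ?addr0 ?add0r.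
Qed.

Lemma gl_part_add : (gl_part false + gl_part true)%VS = fullv.
Proof.
apply/eqP; rewrite eqEsubv subvf /=; apply/subvP=> X _.
by rewrite [X]gl_comp_add memv_add ?gl_comp_part.
Qed.

Lemma gl_part_cap : (gl_part false :&: gl_part true)%VS = 0%VS.
Proof.
apply/eqP; rewrite -subv0; apply/subvP=> X.
rewrite memv_cap => /andP[X0 X1]; rewrite memv0.
by have := gl_comp_id true X1; rewrite (gl_comp_id _ X0) => /= <-.
Qed.

Lemma gl_bracket_linl c X Y Z :
  gl_bracket (c *: X + Y) Z = c *: gl_bracket X Z + gl_bracket Y Z.
Proof.
rewrite /gl_bracket scaler_sumr -big_split; apply: eq_bigr => a _ /=.
rewrite scaler_sumr -big_split; apply: eq_bigr => b _ /=.
rewrite gl_comp_lin mulmxDl mulmxDr -scalemxAl -scalemxAr scalerDr scalerBr.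
by rewrite !scalerA [c * _]mulrC opprD addrACA.
Qed.

Lemma gl_bracket_linr c X Y Z :
  gl_bracket Z (c *: X + Y) = c *: gl_bracket Z X + gl_bracket Z Y.
Proof.
rewrite /gl_bracket scaler_sumr -big_split; apply: eq_bigr => a _ /=.
rewrite scaler_sumr -big_split; apply: eq_bigr => b _ /=.
rewrite gl_comp_lin mulmxDl mulmxDr -scalemxAl -scalemxAr scalerDr scalerBr.
by rewrite !scalerA [c * _]mulrC opprD addrACA.
Qed.

Lemma gl_bracket_part a b X Y : X \in gl_part a -> Y \in gl_part b ->
  gl_bracket X Y \in gl_part (a (+) b).
Proof.
move=> Xa Yb; rewrite (gl_bracketE Xa Yb); apply: memvB; first exact: gl_mul_part.
by apply: memvZ; rewrite addbC; exact: gl_mul_part.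
Qed.

Lemma gl_bracket_skew a b X Y : X \in gl_part a -> Y \in gl_part b ->
  gl_bracket X Y = - ((-1) ^+ (a && b) *: gl_bracket Y X).
Proof.
move=> Xa Yb; rewrite (gl_bracketE Xa Yb) (gl_bracketE Yb Xa) [b && a]andbC.
by rewrite scalerBr scalerA -signr_addb addbb scale1r opprB.
Qed.

Lemma gl_jacobi_homo a b c X Y Z :
  X \in gl_part a -> Y \in gl_part b -> Z \in gl_part c ->
  gl_bracket X (gl_bracket Y Z) =
    gl_bracket (gl_bracket X Y) Z
    + (-1) ^+ (a && b) *: gl_bracket Y (gl_bracket X Z).
Proof.
move=> Xa Yb Zc.
rewrite (gl_bracketE Xa (gl_bracket_part Yb Zc)).
rewrite (gl_bracketE (gl_bracket_part Xa Yb) Zc).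
rewrite (gl_bracketE Yb (gl_bracket_part Xa Zc)).
rewrite (gl_bracketE Xa Yb) (gl_bracketE Xa Zc) (gl_bracketE Yb Zc).
rewrite !(mulmxBr, mulmxBl, scalerBr) -!scalemxAl -!scalemxAr !mulmxA !scalerA.
rewrite -!signr_addb.
case: a b c {Xa Yb Zc} => [] [] [] /=;
  rewrite ?(expr0, expr1, scale1r, scaleN1r, opprK, mulrN1, mulN1r, mulr1);
  apply/matrixP=> r s; rewrite !mxE; ring.
Qed.

Lemma gl_jacobi a b X Y Z : X \in gl_part a -> Y \in gl_part b ->
  gl_bracket X (gl_bracket Y Z) =
    gl_bracket (gl_bracket X Y) Z
    + (-1) ^+ (a && b) *: gl_bracket Y (gl_bracket X Z).
Proof.
move=> Xa Yb.
have addr (U V W : 'M[F]_(n + n)) : gl_bracket U (V + W) = gl_bracket U V + gl_bracket U W.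
  by have := gl_bracket_linr 1 V W U; rewrite !scale1r.
rewrite [Z]gl_comp_add !addr scalerDr addrACA.
by congr (_ + _); apply: gl_jacobi_homo => //; exact: gl_comp_part.
Qed.

Definition gl : lieSuperalgebra F :=
  LieSuperalgebra gl_part_add gl_part_cap gl_bracket_linl gl_bracket_linr
    gl_bracket_part gl_bracket_skew gl_jacobi.

(* The elements of q(n) written E_ij with a tilde (even) and with a bar (odd). *)
Definition tE (i j : 'I_n) : gl :=
  delta_mx (lshift n i) (lshift n j) + delta_mx (rshift n i) (rshift n j).

Definition oE (i j : 'I_n) : gl :=
  delta_mx (lshift n i) (rshift n j) + delta_mx (rshift n i) (lshift n j).

Definition q_space : {vspace gl} :=
  (\sum_(ij : 'I_n * 'I_n) (<[tE ij.1 ij.2]> + <[oE ij.1 ij.2]>))%VS.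

(* The span of the tE i j and oE i j with i < j. *)
Definition n_space : {vspace gl} :=
  (\sum_(ij : 'I_n * 'I_n | (ij.1 < ij.2)%N)
     (<[tE ij.1 ij.2]> + <[oE ij.1 ij.2]>))%VS.

Lemma n_space_sub_q : (n_space <= q_space)%VS.
Proof.
by apply/subv_sumP=> ij _; apply: (sumv_sup ij).
Qed.

Definition n_entries (X : 'M[F]_(n + n)) : Prop := forall i j,
  [/\ X (lshift n i) (lshift n j) = X (rshift n i) (rshift n j),
      X (lshift n i) (rshift n j) = X (rshift n i) (lshift n j)
    & ~~ (i < j)%N ->
      X (lshift n i) (lshift n j) = 0 /\ X (lshift n i) (rshift n j) = 0].

Lemma sum_lt_delta (c : 'I_n * 'I_n -> F) (i j : 'I_n) :
  (~~ (i < j)%N -> c (i, j) = 0) ->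
  \sum_(ij : 'I_n * 'I_n | (ij.1 < ij.2)%N)
    c ij * ((i == ij.1) && (j == ij.2))%:R = c (i, j).
Proof.
move=> c0; have [ij|nij] := boolP (i < j)%N.
  rewrite (bigD1 (i, j)) //= !eqxx mulr1 big1 ?addr0 // => -[i' j'] /=.
  rewrite xpair_eqE => /andP[_ ne].
  by rewrite [i == _]eq_sym [j == _]eq_sym (negPf ne) mulr0.
rewrite big1 => [|[i' j'] /= lt]; first by rewrite c0.
case: eqP => [ei|]; last by rewrite mulr0.
case: eqP => [ej|]; last by rewrite mulr0.
by rewrite ei ej lt in nij.
Qed.

Lemma tE_entries (i j : 'I_n) : (i < j)%N -> n_entries (tE i j).
Proof.
move=> lt i' j'; rewrite !mxE !eq_lrshift !eq_rlshift !eq_lshift !eq_rshift.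
rewrite !andbF /= !addr0 !add0r; split=> // nlt.
rewrite (_ : _ && _ = false) //; apply: contraNF nlt.
by case/andP=> /eqP-> /eqP->.
Qed.

Lemma oE_entries (i j : 'I_n) : (i < j)%N -> n_entries (oE i j).
Proof.
move=> lt i' j'; rewrite !mxE !eq_lrshift !eq_rlshift !eq_lshift !eq_rshift.
rewrite !andbF /= !addr0 !add0r; split=> // nlt.
rewrite (_ : _ && _ = false) //; apply: contraNF nlt.
by case/andP=> /eqP-> /eqP->.
Qed.

Lemma n_entries_lin c X Y : n_entries X -> n_entries Y -> n_entries (c *: X + Y).
Proof.
move=> hX hY i j; have [X1 X2 X3] := hX i j; have [Y1 Y2 Y3] := hY i j.
rewrite !mxE; split; [by rewrite X1 Y1 | by rewrite X2 Y2 |].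
by move=> nij; have [-> ->] := X3 nij; have [-> ->] := Y3 nij; rewrite mulr0 addr0.
Qed.

Lemma n_entries0 : n_entries 0.
Proof. by move=> i j; rewrite !mxE. Qed.

Lemma n_entriesD X Y : n_entries X -> n_entries Y -> n_entries (X + Y).
Proof. by move=> hX; rewrite -[X]scale1r; exact: n_entries_lin. Qed.

Lemma n_entriesZ c X : n_entries X -> n_entries (c *: X).
Proof. by move=> hX; rewrite -[_ *: _]addr0; apply: n_entries_lin => //; exact: n_entries0. Qed.

Lemma n_spaceP (X : gl) : X \in n_space <-> n_entries X.
Proof.
split=> [/memv_sumP[Y hY ->]|hX].
  apply: big_ind => [||ij lt]; [exact: n_entries0 | exact: n_entriesD |].
  have /memv_addP[_ /vlineP[c ->] [_ /vlineP[d ->] ->]] := hY ij lt.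
  by apply: n_entriesD; apply: n_entriesZ; [exact: tE_entries | exact: oE_entries].
have -> : X = \sum_(ij : 'I_n * 'I_n | (ij.1 < ij.2)%N)
   (X (lshift n ij.1) (lshift n ij.2) *: tE ij.1 ij.2
    + X (lshift n ij.1) (rshift n ij.2) *: oE ij.1 ij.2).
  apply/matrixP=> r s; rewrite summxE.
  case: (split_ordP r) => i ->; case: (split_ordP s) => j ->;
    have [X1 X2 X3] := hX i j.
  - rewrite -[LHS](@sum_lt_delta (fun ij => X (lshift n ij.1) (lshift n ij.2))).
      apply: eq_bigr => ij _; rewrite !mxE.
      by rewrite !eq_lrshift !eq_lshift !andbF /= !addr0 mulr0 addr0.
    by move=> /X3[].
  - rewrite -[LHS](@sum_lt_delta (fun ij => X (lshift n ij.1) (rshift n ij.2))).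
      apply: eq_bigr => ij _; rewrite !mxE.
      by rewrite !eq_lrshift !eq_rlshift !eq_lshift !eq_rshift !andbF /= !addr0 mulr0 add0r.
    by move=> /X3[].
  - rewrite -X2 -[LHS](@sum_lt_delta (fun ij => X (lshift n ij.1) (rshift n ij.2))).
      apply: eq_bigr => ij _; rewrite !mxE.
      by rewrite !eq_lrshift !eq_rlshift !eq_lshift !eq_rshift !andbF /= !add0r mulr0 add0r.
    by move=> /X3[].
  - rewrite -X1 -[LHS](@sum_lt_delta (fun ij => X (lshift n ij.1) (lshift n ij.2))).
      apply: eq_bigr => ij _; rewrite !mxE.
      by rewrite !eq_rlshift !eq_rshift !andbF /= !add0r mulr0 addr0.
    by move=> /X3[].
apply: memv_sumr => ij lt.
by apply: memv_add; apply: memvZ; exact: memv_line.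
Qed.

Lemma n_entries_mul X Y : n_entries X -> n_entries Y -> n_entries (X *m Y).
Proof.
move=> hX hY i j; rewrite !mxE !big_split_ord /=; split.
- rewrite addrC; congr (_ + _); apply: eq_bigr => k _;
  by have [X1 X2 _] := hX i k; have [Y1 Y2 _] := hY k j; rewrite ?X1 ?X2 ?Y1 ?Y2.
- rewrite addrC; congr (_ + _); apply: eq_bigr => k _;
  by have [X1 X2 _] := hX i k; have [Y1 Y2 _] := hY k j; rewrite ?X1 ?X2 ?Y1 ?Y2.
move=> nij.
have z k : [/\ X (lshift n i) (lshift n k) = 0 & X (lshift n i) (rshift n k) = 0]
   \/ [/\ Y (lshift n k) (lshift n j) = 0, Y (lshift n k) (rshift n j) = 0,
         Y (rshift n k) (lshift n j) = 0 & Y (rshift n k) (rshift n j) = 0].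
  have [_ _ X3] := hX i k; have [Y1 Y2 Y3] := hY k j.
  have [ik|/X3[-> ->]] := boolP (i < k)%N; last by left.
  right; rewrite -Y1 -Y2; have [|-> ->//] := Y3.
  by apply: contraNN nij; exact: ltn_trans.
by split; rewrite !big1 ?addr0 // => k _; have [[x1 x2]|[y1 y2 y3 y4]] := z k;
  rewrite ?x1 ?x2 ?y1 ?y2 ?y3 ?y4 ?mul0r ?mulr0.
Qed.

Lemma n_entries_comp a X : n_entries X -> n_entries (gl_comp a X).
Proof.
have oddl (i : 'I_n) : idx_odd (lshift n i) = false.
  by rewrite /idx_odd /= leqNgt ltn_ord.
have oddr (i : 'I_n) : idx_odd (rshift n i) = true.
  by rewrite /idx_odd /= leq_addr.
move=> hX i j; have [X1 X2 X3] := hX i j; rewrite !mxE !oddl !oddr /=.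
split; [by rewrite X1 | by rewrite X2 |].
by move=> /X3[-> ->]; rewrite !if_same.
Qed.

Lemma n_bracket X Y : X \in n_space -> Y \in n_space ->
  lsa_bracket X Y \in n_space.
Proof.
move=> /n_spaceP hX /n_spaceP hY; apply/n_spaceP.
apply: big_ind => [||a _]; [exact: n_entries0 | exact: n_entriesD |].
apply: big_ind => [||b _]; [exact: n_entries0 | exact: n_entriesD |].
rewrite addrC -scaleNr; apply: n_entries_lin; apply: n_entries_mul;
  exact: n_entries_comp.
Qed.

Lemma n_graded : (n_space <=
  (n_space :&: lsa_part gl false) + (n_space :&: lsa_part gl true))%VS.
Proof.
apply/subvP=> X /n_spaceP hX; rewrite [X]gl_comp_add.
apply: memv_add; rewrite memv_cap gl_comp_part andbT;
  by apply/n_spaceP; exact: n_entries_comp.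
Qed.

Definition n_superalgebra : lieSuperalgebra F :=
  subSuperalgebra n_graded n_bracket.

End GL.

(* Main.v *)
(* Grade n by height, so that the simple root vectors, which span a complement
   V of [n, n], have degree 1.  The map Lambda_s^2(V) -> n given by the bracket
   has image the degree 2 part of n; let K be its kernel.  Then H^2(n, C) is the
   dual of K, that is, n is presented by its generators V and the quadratic
   relations K:
   - every form on V, extended by zero, is a cocycle, because [n, n] has degree
     at least 2; hence the restriction of cocycles to K is onto;
   - coboundaries vanish on K, and a cocycle f vanishing on K is a coboundary.
     Subtracting a coboundary we may assume f(tE_(i,i+1), x_(i+1,j)) = 0 for all
     i, j.  The cocycle identity, applied with various factorisations of a root
     vector as a bracket, then kills f on all pairs with a simple root vector,
     and an induction on the height kills f.
   With m = n - 1 the dimension of K is 2 m^2 - 2 (m - 1). *)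
Require Import Defs.
From mathcomp Require Import all_boot all_order all_algebra.
From mathcomp Require Import reals complex zify ring.
Set Implicit Arguments.
Unset Strict Implicit.
Unset Printing Implicit Defensive.
Import GRing.Theory Num.Theory.
Local Open Scope ring_scope.

(** * Vanishing of normalised 2-cocycles on root vectors *)

Section TwoCocycleTable.
Variables (F : numFieldType) (n : nat).
(* g i j a k l b stands for f(x_ij(a), x_kl(b)), where x_ij(a) is E_ij with a *)
(* tilde or with a bar for a = false or true, and                             *)
(*   [x_ij(a), x_jl(b)] = x_il(a + b).                                        *)
(* gJ is the cocycle identity at (x_ij(a), x_kl(b), x_lq(c)).                 *)
Variable g : nat -> nat -> bool -> nat -> nat -> bool -> F.
Hypothesis gC : forall i j a k l b, (i < j < n)%N -> (k < l < n)%N ->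
  g i j a k l b = - ((-1) ^+ (a && b) * g k l b i j a).
Hypothesis gJ : forall i j k l q a b c, (i < j < n)%N -> (k < l < q)%N -> (q < n)%N ->
  g i j a k q (b (+) c)
  = (if j == k then g i l (a (+) b) l q c
     else if l == i then - ((-1) ^+ (a && b) * g k j (a (+) b) l q c) else 0)
  + (-1) ^+ (a && b) *
    (if j == l then g k l b i q (a (+) c)
     else if q == i then - ((-1) ^+ (a && c) * g k l b l j (a (+) c)) else 0).
(** This and [g_norm] hold for a cocycle that vanishes on K, once it is normalised by a
    coboundary. *)
Hypothesis g_simple : forall i k a b, (i.+1 < n)%N -> (k.+1 < n)%N ->
  g i i.+1 a k k.+1 b = 0.
Hypothesis g_norm : forall i j b, (i.+2 <= j < n)%N ->
  g i i.+1 false i.+1 j b = 0.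

Ltac ifs := repeat (case: eqP => ?; try (exfalso; lia)).

Let g_left i j a b : (i.+2 <= j < n)%N -> g i i.+1 a i.+1 j b = 0.
Proof.
move=> h; have [e|ne] := eqVneq j i.+2.
  by rewrite e g_simple //; lia.
case: a; last exact: g_norm.
(* For odd a, the cocycle identities with parities (true, false, b) and (false, true, b) share the
   right-hand side f(x_{i,i+2}(true), x_{i+2,j}(b)), and [g_norm] makes the second left-hand side
   0. *)
have -> : b = (false (+) b) by [].
rewrite (@gJ _ _ _ i.+2); [|lia..].
ifs; rewrite ?mulr0 ?addr0 /=.
have := @gJ i i.+1 i.+1 i.+2 j false true b.
rewrite g_norm //; ifs; rewrite ?mulr0 ?addr0 /= => <- //; lia.
Qed.

(** Splitting x_{k,i} after its first simple root leaves a single term, of the shape treated in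
    [g_left]. *)
Let g_right k i a b : (k.+2 <= i)%N -> (i.+1 < n)%N -> g i i.+1 a k i b = 0.
Proof.
move=> h h'; have -> : b = (false (+) b) by [].
rewrite (@gJ _ _ _ k.+1); [|lia..].
ifs; rewrite ?mulr0 ?addr0 ?add0r andbF mul1r g_left ?mulr0 ?oppr0 //; lia.
Qed.

Let eqN0 (x : F) : x = - x -> x = 0.
Proof. by move/esym/eqP; rewrite eqNr => /eqP. Qed.

(* In the next three lemmas, factoring the second argument and moving the      *)
(* brackets around relates values of g on the same pair of roots; for suitable *)
(* parities a value is its own opposite, and the others are multiples of it.   *)
Let g_head k a b : (k.+2 < n)%N -> g k k.+1 a k k.+2 b = 0.
Proof.
move=> h.
have J a' c d : g k k.+1 a' k k.+2 (c (+) d)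
    = (-1) ^+ (a' && c) * g k k.+1 c k k.+2 (a' (+) d).
  rewrite (@gJ _ _ _ k.+1); [|lia..].
  by ifs; rewrite ?mulr0 ?addr0 ?add0r.
have g1 b' : g k k.+1 true k k.+2 b' = 0.
  apply: eqN0; have := J true true (~~ b').
  by rewrite mulN1r /= negbK.
case: a => //; have := J false true (~~ b).
by rewrite /= negbK g1 mulr0.
Qed.

Let g_tail k a b : (k.+2 < n)%N -> g k.+1 k.+2 a k k.+2 b = 0.
Proof.
move=> h.
have J a' c d : g k.+1 k.+2 a' k k.+2 (d (+) c)
    = (-1) ^+ (a' && d) * (-1) ^+ ((a' (+) d) && c) * g k.+1 k.+2 c k k.+2 (a' (+) d).
  rewrite (@gJ _ _ _ k.+1); [|lia..].
  ifs; rewrite ?mulr0 ?addr0 ?add0r gC; [|lia..].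
  by rewrite mulrN opprK mulrA.
have g1 b' : g k.+1 k.+2 true k k.+2 b' = 0.
  apply: eqN0; have := J true true (~~ b').
  by case: b' => /=; rewrite ?(expr0, expr1, mulN1r, mul1r, mulr1).
case: a => //; have := J false true (~~ b).
by rewrite /= addbT negbK => ->; rewrite g1 mulr0.
Qed.

Let g_mid k a b : (k.+3 < n)%N -> g k.+1 k.+2 a k k.+3 b = 0.
Proof.
move=> h.
have J a' c p q : g k.+1 k.+2 a' k k.+3 (c (+) (p (+) q))
    = - ((-1) ^+ (a' && c) * ((-1) ^+ ((a' (+) c) && p) *
        g k.+1 k.+2 p k k.+3 ((a' (+) c) (+) q))).
  (* The first identity leads to the pair (x_{k,k+2}, x_{k+1,k+3}), the second one leads back. *)
  rewrite (@gJ _ _ _ k.+1); [|lia..].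
  ifs; rewrite ?mulr0 ?addr0 ?add0r (@gJ _ _ _ k.+2); [|lia..].
  by ifs; rewrite ?mulr0 ?addr0 ?add0r.
have g0 b' : g k.+1 k.+2 false k k.+3 b' = 0.
  apply: eqN0; have := J false false false b'.
  by rewrite /= !mul1r.
case: a => //; have := J true false false b.
by rewrite /= !mul1r => ->; rewrite g0 oppr0.
Qed.

(** If x_kl splits at some m other than i and i+1, both factors commute with x_{i,i+1} and the
    cocycle identity gives 0. The pairs that admit no such m, or where x_kl is adjacent to
    x_{i,i+1}, are the cases treated before. *)
Let g_simple_left i k l a b : (i.+1 < n)%N -> (k < l < n)%N -> g i i.+1 a k l b = 0.
Proof.
move=> hi hk; have [e|n1] := eqVneq l k.+1; first by rewrite e g_simple //; lia.
have [e|n2] := eqVneq k i.+1; first by rewrite e g_left //; lia.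
have [e|n3] := eqVneq l i; first by rewrite e g_right //; lia.
have split m : (k < m < l)%N -> m != i -> m != i.+1 -> g i i.+1 a k l b = 0.
  move=> hm mi mi1; have -> : b = (false (+) b) by [].
  rewrite (@gJ _ _ _ m); [|lia..].
  by ifs; rewrite ?mulr0 ?addr0.
have [hb|hb] := boolP ((k.+1 != i) && (k.+1 != i.+1)).
  by apply: (split k.+1); lia.
have [e|n4] := eqVneq k i.
  have [e'|n5] := eqVneq l i.+2; last by apply: (split i.+2); lia.
  by rewrite e e' g_head //; lia.
have e : i = k.+1 by lia.
have [e'|n5] := eqVneq l k.+2; first by rewrite e e' g_tail //; lia.
have [e'|n6] := eqVneq l k.+3; first by rewrite e e' g_mid //; lia.
by apply: (split k.+3); lia.
Qed.

(** Induction on the height of the second root. After splitting off its first simple root vector,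
    every surviving term has a second root of smaller height or a simple root vector on the left. *)
Lemma cocycle_table_eq0 i j a k l b : (i < j < n)%N -> (k < l < n)%N -> g i j a k l b = 0.
Proof.
move=> hij hkl; have [d ld] := ubnP (l - k)%N.
elim: d i j a k l b hij hkl ld => // d IH i j a k l b hij hkl ld.
have [e|ne] := eqVneq l k.+1.
  by rewrite e gC ?g_simple_left ?mulr0 ?oppr0 //; lia.
have -> : b = (false (+) b) by [].
rewrite (@gJ _ _ _ k.+1); [|lia..].
by ifs; rewrite ?g_simple_left ?IH ?mulr0 ?oppr0 ?mulr0 ?addr0 //; lia.
Qed.

End TwoCocycleTable.

(** * Cochains of degree at most 2 *)

Section Cochains2.
Variables (F : numFieldType) (L : lieSuperalgebra F).

Local Notation ev1 f x := (@meval F L 1 f [:: x]).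
Local Notation ev2 f x y := (@meval F L 2 f [:: x; y]).
Local Notation "[ x , y ]" := (@lsa_bracket F L x y).

Lemma linear_form0 (h : L -> F) :
  (forall c x y, h (c *: x + y) = c * h x + h y) -> h 0 = 0.
Proof. by move=> /(_ (-1) 0 0); rewrite scaler0 addr0 mulN1r addNr. Qed.

Lemma ev1_lin (f : mform L 1) c x y : ev1 f (c *: x + y) = c * ev1 f x + ev1 f y.
Proof. exact: (meval_multilinear f (u := [::]) (v := [::])). Qed.

Lemma ev2_linl (f : mform L 2) c x y z :
  ev2 f (c *: x + y) z = c * ev2 f x z + ev2 f y z.
Proof. exact: (meval_multilinear f (u := [::]) (v := [:: z])). Qed.

Lemma ev2_linr (f : mform L 2) c x y z :
  ev2 f z (c *: x + y) = c * ev2 f z x + ev2 f z y.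
Proof. exact: (meval_multilinear f (u := [:: z]) (v := [::])). Qed.

Lemma cochain2P (f : mform L 2) :
  f \in cochains L 2 <->
  forall a b x y, x \in lsa_part L a -> y \in lsa_part L b ->
    ev2 f y x = - ((-1) ^+ (a && b) * ev2 f x y).
Proof.
split=> [/cochainP fC a b x y xa yb|fC].
  by have := fC 0%N [:: a; b] [:: x; y]; rewrite /= xa yb => ->.
apply/cochainP => -[|k] e w //= _.
case: w => [|x [|y []]] //= _; case: e => [|a [|b []]] //=; rewrite ?andbF //.
by case/and3P=> xa yb _; exact: fC.
Qed.

(** Skew-symmetry moves [y, z] and [x, z] to the second slot, so that the condition df = 0 takes the
    shape of the Jacobi identity; the signs are compared over the eight parities. *)
Lemma cocycle2P (f : mform L 2) :
  f \in cocycles L 2 <->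
  f \in cochains L 2 /\
  forall a b c x y z,
    x \in lsa_part L a -> y \in lsa_part L b -> z \in lsa_part L c ->
    ev2 f x [y, z] = ev2 f [x, y] z + (-1) ^+ (a && b) * ev2 f y [x, z].
Proof.
have dE a b c x y z : f \in cochains L 2 ->
    x \in lsa_part L a -> y \in lsa_part L b -> z \in lsa_part L c ->
    dformula f [:: a; b; c] [:: x; y; z]
    = ev2 f x [y, z] - (ev2 f [x, y] z + (-1) ^+ (a && b) * ev2 f y [x, z]).
  move=> /cochain2P fC xa yb zc.
  rewrite /dformula !big_nat_recr //= !big_geq // !add0r.
  rewrite /sigma /= !big_nat_recr //= !big_geq // !add0n.
  have /= -> := fC _ _ _ _ xa (lsa_bracket_part yb zc).
  have /= -> := fC _ _ _ _ yb (lsa_bracket_part xa zc).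
  have sg k : (-1) ^+ k = (if odd k then -1 else 1) :> F.
    by rewrite -signr_odd; case: (odd k).
  rewrite !sg !(oddD, oddM, oddb) /=.
  move: (f x _ : F) (f y _ : F) (f (lsa_bracket x y) z : F) => A B C.
  by case: a b c {xa yb zc} => [] [] []; rewrite /=; ring.
split=> [/cocycleP[fC df]|[fC fJ]].
  split=> // a b c x y z xa yb zc; apply/eqP; rewrite -subr_eq0 -(dE a b c) //.
  by rewrite df //= xa yb zc.
apply/cocycleP; split=> // e w; case: w => [|x [|y [|z []]]] //= _.
case: e => [|a [|b [|c []]]] //=; rewrite ?andbF // => /and4P[xa yb zc _].
rewrite dE //; apply/eqP; rewrite subr_eq0.
by rewrite (fJ a b c).
Qed.

Lemma cochains1 : cochains L 1 = fullv.
Proof.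
apply/eqP; rewrite eqEsubv subvf; apply/subvP=> f _.
by apply/cochainP => k e w; rewrite ltnS ltn0.
Qed.

Lemma mform2_ext (f g : mform L 2) : (forall x y, ev2 f x y = ev2 g x y) -> f = g.
Proof.
by move=> fg; apply: meval_ext => e [|x [|y []]].
Qed.

Lemma bracketDl (x y z : L) : [x + y, z] = [x, z] + [y, z].
Proof. by have := lsa_bracket_linl 1 x y z; rewrite !scale1r. Qed.

Lemma bracketDr (x y z : L) : [z, x + y] = [z, x] + [z, y].
Proof. by have := lsa_bracket_linr 1 x y z; rewrite !scale1r. Qed.

Lemma ev1D (f : mform L 1) x y : ev1 f (x + y) = ev1 f x + ev1 f y.
Proof. by have := ev1_lin f 1 x y; rewrite scale1r mul1r. Qed.

Lemma ev2Dl (f : mform L 2) x y z : ev2 f (x + y) z = ev2 f x z + ev2 f y z.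
Proof. by have := ev2_linl f 1 x y z; rewrite scale1r mul1r. Qed.

Lemma ev2Dr (f : mform L 2) x y z : ev2 f z (x + y) = ev2 f z x + ev2 f z y.
Proof. by have := ev2_linr f 1 x y z; rewrite scale1r mul1r. Qed.

Lemma differential1 (f : mform L 1) x y :
  ev2 (differential L 1 f) x y = - ev1 f [x, y].
Proof.
rewrite [x](hcomp_add (L := L)) [y](hcomp_add (L := L)).
rewrite !ev2Dl !ev2Dr !bracketDl !bracketDr !ev1D.
by rewrite !(differential1E f (hcomp_part _ _) (hcomp_part _ _)) !opprD.
Qed.

Lemma mevalN p (f : mform L p) w : meval (- f) w = - meval f w.
Proof.
have := meval_lin (-1) f f w; rewrite scaleN1r addNr mulN1r addNr => m0.
by have := meval_lin (-1) f 0 w; rewrite scaleN1r addr0 mulN1r m0 addr0.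
Qed.

Lemma coboundary2P (f : mform L 2) :
  reflect (exists b : mform L 1, forall x y, ev2 f x y = ev1 b [x, y])
    (f \in coboundaries L 2).
Proof.
rewrite /coboundaries cochains1; apply: (iffP memv_imgP) => [[b _ ->]|[b fb]].
  by exists (- b) => x y; rewrite differential1 mevalN.
exists (- b); first exact: memvf.
by apply: mform2_ext => x y; rewrite fb differential1 mevalN opprK.
Qed.

Lemma linear_mform1 (h : L -> F) :
  (forall c x y, h (c *: x + y) = c * h x + h y) ->
  exists f : mform L 1, forall x, ev1 f x = h x.
Proof.
move=> hlin; exists (linfun (h : L -> F^o)) => x; exact: (@linfun_linE F L F^o h hlin x).
Qed.

Lemma bilinear_mform2 (h : L -> L -> F) :
  (forall c x y z, h (c *: x + y) z = c * h x z + h y z) ->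
  (forall c x y z, h z (c *: x + y) = c * h z x + h z y) ->
  exists f : mform L 2, forall x y, ev2 f x y = h x y.
Proof.
move=> hl hr; exists (linfun (fun x => linfun (h x : L -> F^o))) => x y /=.
have hE z : linfun (h z : L -> F^o) =1 h z.
  exact: (@linfun_linE F L F^o (h z) (fun c u v => hr c u v z)).
rewrite linfun_linE ?hE // => c u v; apply/lfunP => w.
by rewrite add_lfunE scale_lfunE !hE hl.
Qed.

(** The coboundaries lie in the cocycles, and [cohomology] is a complement of them there. *)
Lemma dim_cohomology2 :
  (\dim (cohomology L 2) + \dim (coboundaries L 2))%N = \dim (cocycles L 2).
Proof.
rewrite -(dimv_cap_compl (cocycles L 2) (coboundaries L 2)) addnC.
by rewrite (capv_idPr (coboundaries2_sub L)).
Qed.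

End Cochains2.

(** * The nilpotent subalgebra n *)

(* The pairs of simple roots with j = i + 1 are left out: the two relations   *)
(* in degree alpha_i + alpha_(i+1) are indexed by (i + 1, i).                 *)
Notation relation_index n :=
  {p : 'I_n.-1 * 'I_n.-1 | p.2 != p.1.+1 :> nat}.

Section StrictlyUpper.
Variables (F : numFieldType) (n : nat).

Local Notation L := (n_superalgebra F n).
Local Notation ev1 f x := (@meval F L 1 f [:: x]).
Local Notation ev2 f x y := (@meval F L 2 f [:: x; y]).
Local Notation "[ x , y ]" := (@lsa_bracket F L x y).
Local Notation relIndex := (relation_index n).

(** * Root vectors, their brackets and coordinates *)

Definition nat_delta (i j : nat) : 'M[F]_n :=
  \matrix_(r, s) ((r == i :> nat) && (s == j :> nat))%:R.

(** This is q(n) as the matrix algebra M_n tensored with F[e], where e is odd and e^2 = 1: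
    [qgen a A] is A e^a. *)
Definition qgen (a : bool) (A : 'M[F]_n) : 'M[F]_(n + n) :=
  if a then block_mx 0 A A 0 else block_mx A 0 0 A.

Lemma mul_nat_delta i j k l : (j < n)%N ->
  nat_delta i j *m nat_delta k l = if j == k then nat_delta i l else 0.
Proof.
move=> jn; apply/matrixP=> r s; rewrite mxE (bigD1 (Ordinal jn)) //= big1.
  rewrite !mxE eqxx /= andbT addr0; case: (j =P k) => _; rewrite !mxE /=.
    by rewrite -natrM mulnb.
  by rewrite mulr0.
by move=> t; rewrite -val_eqE !mxE /= => /negPf ->; rewrite andbF mul0r.
Qed.

Lemma mul_qgen a b A B : qgen a A *m qgen b B = qgen (a (+) b) (A *m B).
Proof.
by case: a b => [] []; rewrite /qgen /= mulmx_block !(mulmx0, mul0mx, addr0, add0r).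
Qed.

Lemma qgen_lin a c A B : qgen a (c *: A + B) = c *: qgen a A + qgen a B.
Proof.
by case: a; rewrite /qgen /= scale_block_mx add_block_mx !scaler0 !addr0.
Qed.

Lemma idx_odd_lshift (i : 'I_n) : idx_odd (lshift n i) = false.
Proof. by rewrite /idx_odd /= leqNgt ltn_ord. Qed.

Lemma idx_odd_rshift (i : 'I_n) : idx_odd (rshift n i) = true.
Proof. by rewrite /idx_odd /= leq_addr. Qed.

Lemma qgen_part a A : qgen a A \in gl_part F n a.
Proof.
apply/gl_partP => r s.
by case: (split_ordP r) => i ->; case: (split_ordP s) => j ->;
  rewrite !(idx_odd_lshift, idx_odd_rshift) /qgen; case: a => //= _;
  rewrite ?block_mxEul ?block_mxEur ?block_mxEdl ?block_mxEdr mxE.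
Qed.

Lemma qgen_bracket a b A B :
  gl_bracket (qgen a A) (qgen b B)
  = qgen (a (+) b) (A *m B - (-1) ^+ (a && b) *: (B *m A)).
Proof.
rewrite (gl_bracketE (qgen_part a A) (qgen_part b B)).
by rewrite !mul_qgen [b (+) a]addbC addrC -scaleNr -qgen_lin scaleNr addrC.
Qed.

Lemma qgen_n_space a i j : (i < j)%N -> qgen a (nat_delta i j) \in n_space F n.
Proof.
move=> ij; apply/n_spaceP => r s; rewrite /qgen.
have nz : ~~ (r < s)%N -> (r == i :> nat) && (s == j :> nat) = false by lia.
by case: a; rewrite block_mxEul block_mxEur block_mxEdl block_mxEdr !mxE; split=> // /nz ->.
Qed.

(** The root vector x_ij(a), meaningful for i < j, where [vsproj] keeps the matrix. It is 0 if
    moreover j >= n. *)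
Definition nelt (i j : nat) (a : bool) : L := vsproj (n_space F n) (qgen a (nat_delta i j)).

Local Notation simple i a := (nelt i i.+1 a).

(** The upper two blocks determine a matrix of n, so the coordinates are read there. *)
Definition coord (i j : 'I_n) (a : bool) (x : L) : F :=
  (vsval x : gl F n) (lshift n i) (if a then rshift n j else lshift n j).

Lemma nelt_part i j a : (i < j)%N -> nelt i j a \in lsa_part L a.
Proof.
by move=> ij; rewrite mem_sub_part vsprojK ?qgen_n_space // qgen_part.
Qed.

Lemma qgen0 a : qgen a 0 = 0.
Proof. by case: a; rewrite /qgen -block_mx0. Qed.

Lemma qgenD a A B : qgen a (A + B) = qgen a A + qgen a B.
Proof. by have := qgen_lin a 1 A B; rewrite !scale1r. Qed.

Lemma qgenZ a c A : qgen a (c *: A) = c *: qgen a A.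
Proof. by have := qgen_lin a c A 0; rewrite qgen0 !addr0. Qed.

Lemma nelt_bracket i j k l a b : (i < j < n)%N -> (k < l < n)%N ->
  [nelt i j a, nelt k l b]
  = if j == k then nelt i l (a (+) b)
    else if l == i then - ((-1) ^+ (a && b) *: nelt k j (a (+) b)) else 0.
Proof.
move=> /andP[ij jn] /andP[kl ln]; 
have -> : [nelt i j a, nelt k l b] = vsproj (n_space F n)
    (gl_bracket (qgen a (nat_delta i j)) (qgen b (nat_delta k l))).
  by rewrite {1}/lsa_bracket /= /sub_bracket !vsprojK ?qgen_n_space.
rewrite qgen_bracket !mul_nat_delta //.
case: eqP => [jk|_].
  by case: eqP => [li|_]; [lia | rewrite scaler0 subr0].
case: eqP => [li|_]; last by rewrite scaler0 subr0 qgen0 linear0.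
by rewrite sub0r -scaleNr qgenZ linearZ /= -scaleNr.
Qed.

Lemma coord_lin i j a c x y :
  coord i j a (c *: x + y) = c * coord i j a x + coord i j a y.
Proof. by rewrite /coord vsval_lin !mxE. Qed.

Lemma coord_nelt i j a k l b : (k < l)%N ->
  coord i j a (nelt k l b) = [&& a == b, i == k :> nat & j == l :> nat]%:R.
Proof.
move=> kl; rewrite /coord vsprojK ?qgen_n_space // /qgen.
by case: a b => [] [] /=; rewrite ?block_mxEul ?block_mxEur !mxE.
Qed.

Lemma coord_even i j x : x \in lsa_part L true -> coord i j false x = 0.
Proof.
rewrite mem_sub_part => /gl_partP /(_ (lshift n i) (lshift n j)); apply.
by rewrite !idx_odd_lshift.
Qed.

Lemma coord_odd i j x : x \in lsa_part L false -> coord i j true x = 0.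
Proof.
rewrite mem_sub_part => /gl_partP /(_ (lshift n i) (rshift n j)); apply.
by rewrite idx_odd_lshift idx_odd_rshift.
Qed.

Lemma sum_nelt (x : L) :
  x = \sum_a \sum_(ij : 'I_n * 'I_n | (ij.1 < ij.2)%N)
        coord ij.1 ij.2 a x *: nelt ij.1 ij.2 a.
Proof.
have /n_spaceP hx := subvsP x.
pose A a := \matrix_(i, j) coord i j a x.
have AE a : qgen a (A a) = \sum_(ij : 'I_n * 'I_n | (ij.1 < ij.2)%N)
    coord ij.1 ij.2 a x *: qgen a (nat_delta ij.1 ij.2).
  have -> : A a = \sum_(ij : 'I_n * 'I_n | (ij.1 < ij.2)%N)
      coord ij.1 ij.2 a x *: nat_delta ij.1 ij.2.
    apply/matrixP=> i j; rewrite mxE summxE.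
    rewrite (eq_bigr (fun ij : 'I_n * 'I_n =>
        coord ij.1 ij.2 a x * ((i == ij.1) && (j == ij.2))%:R)).
      rewrite (@sum_lt_delta F n (fun ij : 'I_n * 'I_n => coord ij.1 ij.2 a x)) // => nij.
      by have [_ _ /(_ nij)[z1 z2]] := hx i j; rewrite /coord; case: a.
    by move=> ij _; rewrite !mxE.
  rewrite (big_morph (qgen a) (qgenD a) (qgen0 a)).
  by apply: eq_bigr => ij _; rewrite qgenZ.
apply: subvs_inj; transitivity (\sum_a qgen a (A a) : gl F n).
  rewrite big_bool /= /qgen add_block_mx !(addr0, add0r).
  rewrite -[LHS]submxK; congr block_mx; apply/matrixP=> i j; rewrite !mxE //.
    by have [_ <- _] := hx i j.
  by have [<- _ _] := hx i j.
have vD (u v : L) : vsval (u + v) = vsval u + vsval v by exact: (raddfD vsval).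
have v0 : vsval (0 : L) = 0 by exact: (raddf0 vsval).
have vZ c (u : L) : vsval (c *: u) = c *: vsval u by exact: (linearZZ vsval).
rewrite (big_morph _ vD v0); apply: eq_bigr => a _.
rewrite AE (big_morph _ vD v0); apply: eq_bigr => ij lt.
by rewrite vZ vsprojK ?qgen_n_space.
Qed.

(** * Reduction to root vectors and the criterion for coboundaries *)

Lemma linear_nelt_eq0 (h : L -> F) :
  (forall c x y, h (c *: x + y) = c * h x + h y) ->
  (forall i j a, (i < j < n)%N -> h (nelt i j a) = 0) -> forall x, h x = 0.
Proof.
move=> hlin h0 x; have hz := linear_form0 hlin.
have hD u v : h u = 0 -> h v = 0 -> h (u + v) = 0.
  by move=> hu hv; have := hlin 1 u v; rewrite scale1r hu hv mulr0 addr0.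
rewrite [x]sum_nelt.
apply: (big_ind (fun u => h u = 0)) => // a _.
apply: (big_ind (fun u => h u = 0)) => // ij lt.
by rewrite -[_ *: _]addr0 hlin h0 ?lt ?ltn_ord // hz mulr0 addr0.
Qed.

Lemma bilinear_nelt_eq0 (h : L -> L -> F) :
  (forall c x y z, h (c *: x + y) z = c * h x z + h y z) ->
  (forall c x y z, h z (c *: x + y) = c * h z x + h z y) ->
  (forall i j a k l b, (i < j < n)%N -> (k < l < n)%N ->
     h (nelt i j a) (nelt k l b) = 0) -> forall x y, h x y = 0.
Proof.
move=> hl hr h0 x; apply: linear_nelt_eq0 => [c y z|k l b kl]; first exact: hr.
by apply: (@linear_nelt_eq0 (fun x => h x _)) => // i j a ij; exact: h0.
Qed.

(** The values of f on root vectors satisfy the hypotheses of [cocycle_table_eq0], the brackets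
    being evaluated by [nelt_bracket]. *)
Lemma cocycle_eq0 (f : mform L 2) : f \in cocycles L 2 ->
  (forall i k a b, (i.+1 < n)%N -> (k.+1 < n)%N ->
     ev2 f (nelt i i.+1 a) (nelt k k.+1 b) = 0) ->
  (forall i j b, (i.+2 <= j < n)%N ->
     ev2 f (nelt i i.+1 false) (nelt i.+1 j b) = 0) ->
  f = 0.
Proof.
move=> /cocycle2P[/cochain2P fC fJ] f1 f2.
have e0l z : ev2 f 0 z = 0 := linear_form0 (fun c x y => ev2_linl f c x y z).
have e0r z : ev2 f z 0 = 0 := linear_form0 (fun c x y => ev2_linr f c x y z).
have eNl c x z : ev2 f (- (c *: x)) z = - (c * ev2 f x z).
  by rewrite -scaleNr -[_ *: _]addr0 ev2_linl e0l addr0 mulNr.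
have eNr c x z : ev2 f z (- (c *: x)) = - (c * ev2 f z x).
  by rewrite -scaleNr -[_ *: _]addr0 ev2_linr e0r addr0 mulNr.
have g0 := @cocycle_table_eq0 F n (fun i j a k l b => ev2 f (nelt i j a) (nelt k l b)).
apply: mform2_ext => x y.
rewrite (_ : ev2 0 x y = 0); last by rewrite /= !lfunE.
move: x y; apply: bilinear_nelt_eq0 => [c x y z|c x y z|i j a k l b ij kl].
- exact: ev2_linl.
- exact: ev2_linr.
apply: g0 => // {ij kl i j a k l b} => [i j a k l b ij kl|i j k l q a b c ij kq qn].
  by rewrite [LHS](fC b a) ?[b && a]andbC // nelt_part; lia.
have := fJ a b c (nelt i j a) (nelt k l b) (nelt l q c).
rewrite !nelt_bracket ?eqxx; try lia.
move=> ->; rewrite ?nelt_part //; try lia.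
by congr (_ + _ * _); repeat case: eqP => _; rewrite ?e0l ?e0r ?eNl ?eNr.
Qed.

Definition natcoord (i j : nat) (a : bool) (x : L) : F :=
  if insub i is Some i' then
    if insub j is Some j' then coord i' j' a x else 0
  else 0.

Lemma natcoord_lin i j a c x y :
  natcoord i j a (c *: x + y) = c * natcoord i j a x + natcoord i j a y.
Proof.
rewrite /natcoord; case: insubP => [i' _ _|_]; last by rewrite mulr0 addr0.
by case: insubP => [j' _ _|_]; [rewrite coord_lin | rewrite mulr0 addr0].
Qed.

Lemma natcoord_nelt i j a k l b : (k < l < n)%N ->
  natcoord i j a (nelt k l b) = [&& a == b, i == k & j == l]%:R.
Proof.
move=> /andP[kl ln]; rewrite /natcoord; case: insubP => [i' _ <-|i'].
  case: insubP => [j' _ <-|j']; first by rewrite coord_nelt.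
  by rewrite (_ : j == l = false) ?andbF //; lia.
by rewrite (_ : i == k = false) ?andbF //; lia.
Qed.

Lemma natcoord_part i j a b x : x \in lsa_part L b -> a != b ->
  natcoord i j a x = 0.
Proof.
rewrite /natcoord; case: insubP => // i' _ _; case: insubP => // j' _ _.
by case: a b => [] [] // xb _; [exact: coord_odd | exact: coord_even].
Qed.

(** A bracket of root vectors has height at least 2, so it has no simple component. *)
Lemma natcoord_bracket i a x y : natcoord i i.+1 a [x, y] = 0.
Proof.
move: x y; apply: bilinear_nelt_eq0 => [c x y z|c x y z|].
- by rewrite lsa_bracket_linl natcoord_lin.
- by rewrite lsa_bracket_linr natcoord_lin.
move=> j k b l m c jk lm; rewrite nelt_bracket //.
have nz := linear_form0 (natcoord_lin i i.+1 a).
case: eqP => [kl|_].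
  rewrite natcoord_nelt; last by lia.
  by rewrite (_ : (i == j) && _ = false) ?andbF //; lia.
case: eqP => [mj|_ //].
rewrite -scaleNr -[_ *: _]addr0 natcoord_lin nz addr0.
rewrite natcoord_nelt; last by lia.
by rewrite (_ : (i == l) && _ = false) ?andbF ?mulr0 ?oppr0 //; lia.
Qed.

(* The hypotheses say that f vanishes on the kernel of the bracket from the   *)
(* super exterior square of the span of the simple root vectors to n.         *)
Lemma coboundary_crit (f : mform L 2) : f \in cocycles L 2 ->
  (forall i k a b, (i.+1 < n)%N -> (k.+1 < n)%N -> k != i.+1 -> i != k.+1 ->
     ev2 f (nelt i i.+1 a) (nelt k k.+1 b) = 0) ->
  (forall i b, (i.+2 < n)%N ->
     ev2 f (nelt i i.+1 true) (nelt i.+1 i.+2 b)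
     = ev2 f (nelt i i.+1 false) (nelt i.+1 i.+2 (~~ b))) ->
  f \in coboundaries L 2.
Proof.
move=> fZ f1 f2.
(* Subtracting be o [ , ] normalises f to vanish at (tE_(i,i+1), x_(i+1,j)). *)
pose be x := \sum_a \sum_(i < n) \sum_(j < n | (i.+2 <= j)%N)
  natcoord i j a x * ev2 f (nelt i i.+1 false) (nelt i.+1 j a).
have be_lin c x y : be (c *: x + y) = c * be x + be y.
  rewrite /be mulr_sumr -big_split; apply: eq_bigr => a _ /=.
  rewrite mulr_sumr -big_split; apply: eq_bigr => i _ /=.
  rewrite mulr_sumr -big_split; apply: eq_bigr => j _ /=.
  by rewrite natcoord_lin mulrDl mulrA.
have [b bE] := linear_mform1 be_lin.
have beE i j a : (i.+2 <= j < n)%N ->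
    be (nelt i j a) = ev2 f (nelt i i.+1 false) (nelt i.+1 j a).
  move=> /andP[ij jn]; have i_n : (i < n)%N by lia.
  rewrite /be (bigD1 a) //= (bigD1 (Ordinal i_n)) //= (bigD1 (Ordinal jn)) //=.
  rewrite natcoord_nelt ?eqxx /= ?mul1r; last by lia.
  rewrite !big1 ?addr0 // => [a' na|i' ni|j' /andP[_ nj]].
  - rewrite big1 // => i' _; rewrite big1 // => j' _.
    by rewrite natcoord_nelt ?(negPf na) ?mul0r //; lia.
  - rewrite big1 // => j' _; rewrite natcoord_nelt; last by lia.
    by move: ni; rewrite -val_eqE /= => /negPf ->; rewrite andbF mul0r.
  - rewrite natcoord_nelt; last by lia.
    by move: nj; rewrite -val_eqE /= => /negPf ->; rewrite !andbF mul0r.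
have br_lin1 c x y z : ev1 b [c *: x + y, z] = c * ev1 b [x, z] + ev1 b [y, z].
  by rewrite lsa_bracket_linl ev1_lin.
have br_lin2 c x y z : ev1 b [z, c *: x + y] = c * ev1 b [z, x] + ev1 b [z, y].
  by rewrite lsa_bracket_linr ev1_lin.
have [g gE] := bilinear_mform2 br_lin1 br_lin2.
have gB : g \in coboundaries L 2 by apply/coboundary2P; exists b.
have gZ := subvP (coboundaries2_sub L) g gB.
suff /eqP : f - g = 0 by rewrite subr_eq0 => /eqP ->.
have dE x y : ev2 (f - g) x y = ev2 f x y - be [x, y].
  by rewrite addrC -scaleN1r meval_lin mulN1r addrC gE bE.
have norm i j a : (i.+2 <= j < n)%N ->
    ev2 (f - g) (nelt i i.+1 false) (nelt i.+1 j a) = 0.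
  by move=> ij; rewrite dE nelt_bracket ?eqxx ?beE ?subrr //; lia.
have dZ : f - g \in cocycles L 2 by rewrite memvB.
have adj i a c : (i.+2 < n)%N ->
    ev2 (f - g) (nelt i i.+1 a) (nelt i.+1 i.+2 c) = 0.
  (* For odd a, [f2] passes to the product with first factor even. Its bracket is the same, and
     there [be] was chosen to agree with f. *)
  move=> hi; case: a; last by apply: norm; lia.
  rewrite dE f2 // nelt_bracket ?eqxx ?beE ?subrr //; lia.
apply: cocycle_eq0 => // i k a c hi hk.
have [e|n1] := eqVneq k i.+1; first by subst k; rewrite adj.
have [e|n2] := eqVneq i k.+1.
  have /cocycle2P[/cochain2P dC _] := dZ.
  subst i; rewrite (dC c a) ?adj ?mulr0 ?oppr0 //; exact: nelt_part.
(* The remaining simple root vectors commute, so [be] contributes 0 and [f1] applies. *)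
have be0 := linear_form0 be_lin.
rewrite dE f1 // nelt_bracket; try lia.
by rewrite eq_sym (negPf n1) eq_sym (negPf n2) be0 subrr.
Qed.

(** Values of f at a basis of K. For i = j + 1 the basis vector is the difference of two products
    with equal bracket; otherwise it is one product of commuting vectors. For c = false, the pairs j
    < i then carry even wedges and the pairs i <= j symmetric products of odd vectors, squares
    included. *)
Definition relation_value (f : mform L 2) (i j : nat) (c : bool) : F :=
  if c then
    if i == j.+1 then
      ev2 f (simple j false) (simple i true) - ev2 f (simple j true) (simple i false)
    else ev2 f (simple i false) (simple j true)
  else if i == j.+1 then
    ev2 f (simple j true) (simple i true) - ev2 f (simple j false) (simple i false)
  else if (j < i)%N then ev2 f (simple i false) (simple j false)
  else ev2 f (simple i true) (simple j true).

Lemma relation_value_lin i j a c (f g : mform L 2) :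
  relation_value (c *: f + g) i j a
  = c * relation_value f i j a + relation_value g i j a.
Proof.
rewrite /relation_value; case: a; do 2?case: ifP => _; rewrite !meval_lin //; ring.
Qed.

Definition relation_values (f : mform L 2) : {ffun relIndex * bool -> F^o} :=
  [ffun u : relIndex * bool => relation_value f (val u.1).1 (val u.1).2 u.2 : F^o].

Definition relation_map : 'Hom(mform L 2, {ffun relIndex * bool -> F^o}) :=
  linfun relation_values.

Lemma relation_mapE f : relation_map f = relation_values f.
Proof.
apply: (@linfun_linE F (mform L 2) {ffun relIndex * bool -> F^o} relation_values).
by move=> c g h; apply/ffunP=> u; rewrite !ffunE relation_value_lin.
Qed.

Lemma relation_mapP f :
  reflect (forall i j a, (i < n.-1)%N -> (j < n.-1)%N -> j != i.+1 ->
             relation_value f i j a = 0)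
    (f \in lker relation_map).
Proof.
rewrite memv_ker relation_mapE; apply: (iffP eqP) => [f0 i j a hi hj ij|f0].
  have := congr1 (fun u : {ffun _ -> _} =>
    u (exist _ (Ordinal hi, Ordinal hj) ij : relIndex, a)) f0.
  by rewrite !ffunE.
apply/ffunP=> -[[[i j] ij] a]; rewrite !ffunE /=; exact: f0.
Qed.

(** Relations bracket to 0, hence coboundaries vanish on them. Conversely, zero relation values and
    skew-symmetry give the hypotheses of [coboundary_crit]. *)
Lemma coboundaries_relation :
  coboundaries L 2 = (cocycles L 2 :&: lker relation_map)%VS.
Proof.
apply/eqP; rewrite eqEsubv; apply/andP; split; apply/subvP => f.
  move=> fB; rewrite memv_cap (subvP (coboundaries2_sub L)) //=.
  apply/relation_mapP => i j a hi hj ij.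
  have /coboundary2P[b bE] := fB.
  have b0 : ev1 b 0 = 0 := linear_form0 (ev1_lin b).
  rewrite /relation_value !bE; case: ifP => _; case: eqP => e;
    rewrite ?e !nelt_bracket ?eqxx; try lia; rewrite ?subrr //.
    by case: eqP => [|_]; [lia | case: eqP => [|_ //]; lia].
  by case: ifP => _; (case: eqP => [|_]; [lia | case: eqP => [|_ //]; lia]).
rewrite memv_cap => /andP[fZ /relation_mapP f0].
have /cocycle2P[/cochain2P fC _] := fZ.
have skew i j a b : ev2 f (simple i a) (simple j b)
    = - ((-1) ^+ (a && b) * ev2 f (simple j b) (simple i a)).
  by rewrite [LHS](fC b a) ?[b && a]andbC // nelt_part.
apply: coboundary_crit => // [i k a b hi hk ki ik|i b hi].
  have [hi' hk'] : (i < n.-1)%N /\ (k < n.-1)%N by split; lia.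
  have r1 c : relation_value f i k c = 0 by apply: f0.
  have r2 c : relation_value f k i c = 0 by apply: f0.
  have mixed : ev2 f (simple i false) (simple k true) = 0.
    by have := r1 true; rewrite /relation_value (negPf ik).
  (* A mixed relation has its even factor first, so this value is read at the transposed index (k,
     i). *)
  have mixed' : ev2 f (simple i true) (simple k false) = 0.
    rewrite skew; have := r2 true; rewrite /relation_value (negPf ki) => ->.
    by rewrite mulr0 oppr0.
  case: a b => [] [] //.
    have [lt|le] := ltnP k i.
      rewrite skew; have := r2 false; rewrite /relation_value (negPf ki) ltnNge (ltnW lt) /=.
      by move=> ->; rewrite mulr0 oppr0.
    by have := r1 false; rewrite /relation_value (negPf ik) ltnNge le.
  have [lt|lt|e] := ltngtP k i.
  - by have := r1 false; rewrite /relation_value (negPf ik) lt.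
  - rewrite skew; have := r2 false; rewrite /relation_value (negPf ki) lt.
    by move=> ->; rewrite mulr0 oppr0.
  (* For an even vector paired with itself, skew-symmetry makes the value its own opposite. *)
  - subst k; apply/eqP; rewrite -eqNr; apply/eqP.
    by rewrite {2}skew mul1r.
have hi1 : (i.+1 < n.-1)%N by lia.
have := f0 i.+1 i (~~ b) hi1 (ltnW hi1); rewrite /relation_value eqxx.
case: b => /(_ _) /=; last first.
  by move=> r; apply/esym/eqP; rewrite -subr_eq0; apply/eqP/r; lia.
by move=> r; apply/eqP; rewrite -subr_eq0; apply/eqP/r; lia.
Qed.

(** * Cocycles with prescribed values on the relations *)

Section Lift.
Variable phi : nat -> nat -> bool -> F.

(* Gram matrix, on the simple root vectors, of a super-alternating form with  *)
(* the values phi on the relations.                                           *)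
Definition lift_coef (i : nat) (a : bool) (j : nat) (b : bool) : F :=
  match a, b with
  | false, false =>
      if (j.+1 < i)%N then phi i j false
      else if (i.+1 < j)%N then - phi j i false else 0
  | true, true =>
      let p := minn i j in let q := maxn i j in
      if q == p.+1 then phi q p false else phi p q false
  | false, true =>
      if j == i.+1 then phi j i true else if i == j.+1 then 0 else phi i j true
  | true, false =>
      - (if i == j.+1 then phi i j true else if j == i.+1 then 0 else phi j i true)
  end.

Lemma lift_coefC i a j b :
  lift_coef i a j b = - ((-1) ^+ (a && b) * lift_coef j b i a).
Proof.
case: a b => [] [] /=; rewrite ?mulN1r ?mul1r ?opprK //.
  by rewrite minnC maxnC.
case: (ltnP j.+1 i) => ji; case: (ltnP i.+1 j) => ij; rewrite ?opprK ?oppr0 //; lia.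
Qed.

Definition lift_form (x y : L) : F :=
  \sum_(p : 'I_n.-1 * bool) \sum_(q : 'I_n.-1 * bool)
    lift_coef p.1 p.2 q.1 q.2
    * (natcoord p.1 p.1.+1 p.2 x * natcoord q.1 q.1.+1 q.2 y).

Lemma lift_form_linl c x y z : lift_form (c *: x + y) z = c * lift_form x z + lift_form y z.
Proof.
rewrite /lift_form mulr_sumr -big_split; apply: eq_bigr => p _ /=.
rewrite mulr_sumr -big_split; apply: eq_bigr => q _ /=.
by rewrite natcoord_lin; ring.
Qed.

Lemma lift_form_linr c x y z : lift_form z (c *: x + y) = c * lift_form z x + lift_form z y.
Proof.
rewrite /lift_form mulr_sumr -big_split; apply: eq_bigr => p _ /=.
rewrite mulr_sumr -big_split; apply: eq_bigr => q _ /=.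
by rewrite natcoord_lin; ring.
Qed.

Lemma lift_form_simple i a j b : (i < n.-1)%N -> (j < n.-1)%N ->
  lift_form (simple i a) (simple j b) = lift_coef i a j b.
Proof.
move=> hi hj; rewrite /lift_form (bigD1 (Ordinal hi, a)) //= (bigD1 (Ordinal hj, b)) //=.
rewrite !natcoord_nelt ?eqxx ?mulr1; [|lia..].
rewrite !big1 ?addr0 //= => [[i' a']|[j' b']] /=; rewrite xpair_eqE -val_eqE /= => ne.
  rewrite big1 // => q _; rewrite natcoord_nelt; last by lia.
  by move: ne; rewrite eqSS andbb andbC => /negPf ->; rewrite mul0r mulr0.
rewrite [X in _ * (_ * X)]natcoord_nelt; last by lia.
by move: ne; rewrite eqSS andbb andbC => /negPf ->; rewrite !mulr0.
Qed.

Lemma lift_form_skew a b x y : x \in lsa_part L a -> y \in lsa_part L b ->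
  lift_form y x = - ((-1) ^+ (a && b) * lift_form x y).
Proof.
move=> xa yb; rewrite /lift_form mulr_sumr -sumrN exchange_big; apply: eq_bigr => p _ /=.
rewrite mulr_sumr -sumrN; apply: eq_bigr => q _ /=.
(* Only coordinates of the parities of x and y survive, and for these [lift_coefC] has the required
   sign. *)
have [pa|na] := eqVneq p.2 a; last by rewrite (natcoord_part _ _ xa na); ring.
have [qb|nb] := eqVneq q.2 b; last by rewrite (natcoord_part _ _ yb nb); ring.
by rewrite lift_coefC pa qb [b && a]andbC; ring.
Qed.

(** The form only sees simple coordinates, which vanish on [n, n]; every term of the cocycle
    identity is 0. *)
Lemma lift_form_cocycle f : (forall x y, ev2 f x y = lift_form x y) ->
  f \in cocycles L 2.
Proof.
have l0 x y z : lift_form x [y, z] = 0.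
  rewrite /lift_form big1 // => p _; rewrite big1 // => q _.
  by rewrite [natcoord _ _ _ [_, _]]natcoord_bracket !mulr0.
have r0 x y z : lift_form [y, z] x = 0.
  rewrite /lift_form big1 // => p _; rewrite big1 // => q _.
  by rewrite [natcoord _ _ _ [_, _]]natcoord_bracket mul0r mulr0.
move=> fE; apply/cocycle2P; split=> [|a b c x y z _ _ _].
  by apply/cochain2P => a b x y xa yb; rewrite !fE; exact: lift_form_skew.
by rewrite !fE !l0 r0 mulr0 addr0.
Qed.

(** In the difference attached to an adjacent pair, [lift_coef] gives one product the value of [phi]
    and the other one 0. *)
Lemma relation_value_lift f i j c : (forall x y, ev2 f x y = lift_form x y) ->
  (i < n.-1)%N -> (j < n.-1)%N -> j != i.+1 -> relation_value f i j c = phi i j c.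
Proof.
move=> fE hi hj ij; rewrite /relation_value !fE !lift_form_simple //.
rewrite /lift_coef; case: c; case: (i =P j.+1) => [e|ne] /=.
- by rewrite (negPf ij) oppr0 subr0.
- by rewrite (negPf ij).
- have -> : minn j i = j by lia.
  have -> : maxn j i = i by lia.
  by rewrite -e eqxx e ltnn (_ : (j.+2 < j)%N = false) ?subr0 //; lia.
case: (ltnP j i) => ji.
  by rewrite (_ : (j.+1 < i)%N) //; lia.
by rewrite (negPf ij).
Qed.

End Lift.

Lemma relation_map_surj : (relation_map @: cocycles L 2)%VS = fullv.
Proof.
apply/eqP; rewrite eqEsubv subvf; apply/subvP => /= w _.
(* The target vector w at natural indices, with default 0 off the relation indices. *)
pose phi i j c : F := if [pick u : relIndex * bool |
    [&& (val u.1).1 == i :> nat, (val u.1).2 == j :> nat & u.2 == c]] is Some u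
  then w u else 0.
have phiE (u : relIndex * bool) : phi (val u.1).1 (val u.1).2 u.2 = w u.
  rewrite /phi; case: pickP => [v|/(_ u)]; last by rewrite !eqxx.
  case/and3P => /eqP e1 /eqP e2 /eqP e3; congr (w _).
  case: u v e1 e2 e3 => [u1 u2] [v1 v2] /= /ord_inj e1 /ord_inj e2 ->; congr (_, _).
  by apply: val_inj; rewrite [LHS]surjective_pairing [RHS]surjective_pairing e1 e2.
have [f fE] := bilinear_mform2 (lift_form_linl phi) (lift_form_linr phi).
apply/memv_imgP; exists f; first exact: lift_form_cocycle fE.
rewrite relation_mapE; apply/ffunP=> u; rewrite ffunE -phiE.
by rewrite (relation_value_lift _ fE) // (valP u.1).
Qed.

(** Rank-nullity for [relation_map] on the cocycles: the kernel is the space of coboundaries and the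
    image is everything. *)
Lemma dim_cohomology2_relations : \dim (cohomology L 2) = (2 * #|{: relIndex}|)%N.
Proof.
apply/eqP; rewrite -(eqn_add2r (\dim (coboundaries L 2))) dim_cohomology2.
rewrite -(limg_ker_dim relation_map) -coboundaries_relation relation_map_surj.
by rewrite addnC eqn_add2r dimvf /dim /= card_prod card_bool muln1 mulnC.
Qed.

End StrictlyUpper.

(** Here n = m + 2: of the (m + 1)^2 pairs of simple roots, the m pairs (i, i + 1) are removed. *)
Lemma card_relation_index m : #|{: relation_index m.+2}| = (m * m.+1 + 1)%N.
Proof.
rewrite card_sig.
have := cardC (fun p : 'I_m.+1 * 'I_m.+1 => p.2 == p.1.+1 :> nat).
rewrite card_prod card_ord.
have -> : #|[pred p : 'I_m.+1 * 'I_m.+1 | p.2 == p.1.+1 :> nat]| = m.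
  rewrite -sum1_card big_mkcond /=.
  rewrite -(pair_bigA _ (fun i j : 'I_m.+1 => if j == i.+1 :> nat then 1 else 0))%N /=.
  (* The last row contributes nothing, its successor being out of range; each other row contributes
     one pair. *)
  rewrite big_ord_recr /= [X in (_ + X)%N]big1 => [|j _]; last first.
    by case: eqP => // e; have := ltn_ord j; lia.
  rewrite addn0 (eq_bigr (fun=> 1%N)) ?sum1_card ?card_ord // => i _.
  have h : (i.+1 < m.+1)%N by rewrite ltnS ltn_ord.
  rewrite (bigD1 (Ordinal h)) //= eqxx big1 // => j.
  by rewrite -val_eqE /= => /negPf ->.
move=> e; apply/eqP; rewrite -(eqn_add2l m); apply/eqP.
transitivity (m.+1 * m.+1)%N; last by lia.
by rewrite -e; congr (_ + _)%N; exact: eq_card.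
Qed.

Theorem mainTheorem9 (R : realType) (n : nat) (hn : (2 <= n)%N) :
  (\dim (cohomology (n_superalgebra R[i] n) 2))%:Z
    = 2 * n%:Z ^+ 2 - 6 * n%:Z + 6.
Proof.
case: n hn => [|[|m]] // _.
by rewrite dim_cohomology2_relations card_relation_index; lia.
Qed.
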